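(* Let $K$ be a field. For any integers $\ell,r,\overline{\omega}$ with $3\le\ell\le r\le\overline{\omega}$, there exists a connected finite simple graph $G$ with $\ell(G)=\ell$, $\operatorname{reg}(S/J_G)=r$ and $|V(G)|-\omega(G)+1=\overline{\omega}$.
   Context: For a graph $G$ on a vertex set identified with $[n]$, $S=K[x_1,\dots,x_n,y_1,\dots,y_n]$ and $J_G\subseteq S$ is the binomial edge ideal, generated by $x_iy_j-x_jy_i$ for all edges $\{i,j\}$ with $i<j$; $\operatorname{reg}$ is Castelnuovo–Mumford regularity. $\ell(G)$ is the length (number of edges) of a longest induced path in $G$; $\omega(G)$ is the clique number. *)

(* Defs.v *)
From HB Require Import structures.
From mathcomp Require Import all_boot all_order all_algebra.
From mathcomp Require Import mpoly.
Set Implicit Arguments. Unset Strict Implicit. Unset Printing Implicit Defensive.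
Import GRing.Theory.
Local Open Scope ring_scope.

Record sgraph (n : nat) := SGraph {
  adj : rel 'I_n;
  adj_sym : ssrbool.symmetric adj;
  adj_irr : irreflexive adj }.

Definition connected_graph n (G : sgraph n) : Prop :=
  forall u v : 'I_n, connect (adj G) u v.

Definition induced_path n (G : sgraph n) (k : nat) (p : 'I_k.+1 -> 'I_n) : Prop :=
  injective p /\
  forall a b : 'I_k.+1,
    adj G (p a) (p b) = ((val a == (val b).+1) || (val b == (val a).+1)).

Definition longest_induced_path_is n (G : sgraph n) (l : nat) : Prop :=
  (exists p, @induced_path n G l p) /\
  (forall k p, @induced_path n G k p -> (k <= l)%N).

Definition is_clique n (G : sgraph n) (C : {set 'I_n}) : bool :=
  [forall u in C, forall v in C, (u != v) ==> adj G u v].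

Definition clique_number n (G : sgraph n) : nat :=
  \max_(C : {set 'I_n} | is_clique G C) #|C|.

Definition xv (K : fieldType) n (i : 'I_n) : {mpoly K[n + n]} := 'X_(lshift n i).
Definition yv (K : fieldType) n (i : 'I_n) : {mpoly K[n + n]} := 'X_(rshift n i).

Definition fgen (K : fieldType) n (i j : 'I_n) : {mpoly K[n + n]} :=
  xv K i * yv K j - xv K j * yv K i.

Definition in_JG (K : fieldType) n (G : sgraph n) (f : {mpoly K[n + n]}) : Prop :=
  exists g : 'I_n -> 'I_n -> {mpoly K[n + n]},
    f = \sum_(i < n) \sum_(j < n | (i < j)%N && adj G i j) g i j * fgen K i j.

Definition has_dim (K : fieldType) (V : lmodType K) (P : V -> Prop) (d : nat) : Prop :=
  exists b : 'I_d -> V,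
    (forall k, P (b k)) /\
    (forall c : 'I_d -> K, \sum_(k < d) c k *: b k = 0 -> forall k, c k = 0) /\
    (forall v, P v -> exists c : 'I_d -> K, v = \sum_(k < d) c k *: b k).

(* Graded Betti numbers of M = S/J_G, computed as graded Koszul homology:
   beta_{i,j}(M) = dim_K Tor_i^S(K, M)_j = dim_K H_i(x,y; M)_j.
   A Koszul chain with values in S is a finite function
   A (subset of the 2n variables) |-> coefficient of e_A;                 *)
Definition kchain (K : fieldType) n := {ffun {set 'I_(n + n)} -> {mpoly K[n + n]}}.

(* (lifts of) elements of K_i(x,y; M)_j: supported on |A| = i, coefficients
   homogeneous of degree j - i (0 if j < i).                              *)
Definition kdeg (K : fieldType) n (i j : nat) (c : kchain K n) : Prop :=
  forall A, c A = 0 \/ (#|A| = i /\ exists d : nat, (i + d)%N = j /\ c A \is d.-homog).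

(* Koszul differential: d(e_A m) = sum_{k in A} (-1)^{#{a in A | a < k}} x_k m e_{A - k} *)
Definition kdiff (K : fieldType) n (c : kchain K n) : kchain K n :=
  [ffun B : {set 'I_(n + n)} =>
     \sum_(k : 'I_(n + n) | k \notin B)
        (-1) ^+ #|[set b in B | (b < k)%N]| * 'X_k * c (k |: B)].

(* cycles of K_i(x,y;S/J)_j, lifted to S *)
Definition kcycle (K : fieldType) n (G : sgraph n) (i j : nat) (c : kchain K n) : Prop :=
  kdeg i j c /\ forall B, in_JG G (kdiff c B).

(* boundaries of K_i(x,y;S/J)_j, lifted to S (image of d plus J-multiples) *)
Definition kbound (K : fieldType) n (G : sgraph n) (i j : nat) (c : kchain K n) : Prop :=
  kdeg i j c /\
  exists c' : kchain K n, kdeg i.+1 j c' /\ forall A, in_JG G (c A - kdiff c' A).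

Definition betti_is (K : fieldType) n (G : sgraph n) (i j b : nat) : Prop :=
  exists dz db : nat,
    has_dim (@kcycle K n G i j) dz /\ has_dim (@kbound K n G i j) db /\ b = (dz - db)%N.

Definition reg_quot_is (K : fieldType) n (G : sgraph n) (r : nat) : Prop :=
  (exists i j b, betti_is K G i j b /\ b <> 0%N /\ j = (i + r)%N) /\
  (forall i j b, betti_is K G i j b -> b <> 0%N -> (j <= i + r)%N).

(* Main.v *)
(* The graph is a clique on [q + 2] vertices with a path of [l - 2] edges attached
   at one vertex, a single leaf at each of [q = r - l] others, and a star of
   [w - r + 1] leaves at the last vertex [v].

   The path edges and single leaves form a regular sequence of quadrics on the
   coordinate ring of the clique, so each raises the regularity by one.  Let [J]
   be the ideal after at least one leaf has been attached at [v], and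
   [f = x_v y_u - x_u y_v] the generator of a further one: then [J : f] is the
   ideal of the same graph with [v] and its leaves completed to a clique, of
   regularity one less, and the exact sequence of [f] shows that the regularity
   does not grow.  For the clique itself, [x_v] is regular, and modulo [x_v] the
   colon by [y_v] is generated by variables, which gives regularity at most 1 by
   induction.  Nonvanishing is propagated upwards: a regular quadric kills the
   Koszul homology, so classes lift; and adding edges at a vertex whose variables
   did not occur before does not kill a class, as one sees modulo these
   variables, which are regular. *)
Require Import Defs.
From HB Require Import structures.
From mathcomp Require Import all_boot all_order all_algebra.
From mathcomp Require Import mpoly.
From mathcomp Require Import ssrcomplements ring zify.
From Stdlib Require Import Classical.
Set Implicit Arguments. Unset Strict Implicit. Unset Printing Implicit Defensive.
Import GRing.Theory.
Local Open Scope ring_scope.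

(** * Ideals and division by a variable *)

Section Ideals.
Variable R : comNzRingType.
Implicit Types (P Q : R -> Prop) (f g p q : R).

Inductive ideal P : R -> Prop :=
| ideal0 : ideal P 0
| ideal_add a g p : P g -> ideal P p -> ideal P (a * g + p).

Definition addgen P f : R -> Prop := fun g => P g \/ g = f.

(** [f] is a nonzerodivisor on the quotient by the ideal of [P]; the zero quotient is allowed. *)
Definition nzd P f := forall c, ideal P (f * c) -> ideal P c.

Lemma ideal_gen P g : P g -> ideal P g.
Proof. by move=> Pg; rewrite -[g]addr0 -[g]mul1r; exact/ideal_add/ideal0. Qed.

Lemma idealD P p q : ideal P p -> ideal P q -> ideal P (p + q).
Proof.
move=> Ip Iq; elim: Ip => [|a g r Pg _ IH]; first by rewrite add0r.
by rewrite -addrA; exact: ideal_add.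
Qed.

Lemma idealMl P a p : ideal P p -> ideal P (a * p).
Proof.
elim=> [|b g r Pg _ IH]; first by rewrite mulr0; exact: ideal0.
by rewrite mulrDr mulrA; exact: ideal_add.
Qed.

Lemma idealMr P a p : ideal P p -> ideal P (p * a).
Proof. by rewrite mulrC; exact: idealMl. Qed.

Lemma idealN P p : ideal P p -> ideal P (- p).
Proof. by rewrite -mulN1r; exact: idealMl. Qed.

Lemma idealB P p q : ideal P p -> ideal P q -> ideal P (p - q).
Proof. by move=> Ip Iq; apply/idealD/idealN. Qed.

Lemma ideal_sum P (I : Type) (r : seq I) (Q : pred I) (F : I -> R) :
  (forall i, Q i -> ideal P (F i)) -> ideal P (\sum_(i <- r | Q i) F i).
Proof. by move=> h; apply: big_ind => //; [exact: ideal0 | exact: idealD]. Qed.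

Lemma ideal_sub P Q p : (forall g, P g -> ideal Q g) -> ideal P p -> ideal Q p.
Proof.
move=> PQ; elim=> [|a g r /PQ Qg _ IH]; first exact: ideal0.
exact/idealD/IH/idealMl.
Qed.

Lemma ideal_addgenP P f p : ideal (addgen P f) p <-> exists a, ideal P (p - a * f).
Proof.
split=> [|[a Ip]].
- elim=> [|a g r [Pg|->] _ [b Ib]]; first by exists 0; rewrite mul0r subr0; exact: ideal0.
  + by exists b; rewrite -addrA; exact: ideal_add.
  + by exists (a + b); rewrite mulrDl opprD addrACA subrr add0r.
- rewrite -[p](subrK (a * f)); apply: idealD.
  + by apply: ideal_sub Ip => g Pg; apply: ideal_gen; left.
  + by apply/idealMl/ideal_gen; right.
Qed.

Lemma ideal_addgenW P f p : ideal P p -> ideal (addgen P f) p.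
Proof. by apply: ideal_sub => g Pg; apply: ideal_gen; left. Qed.

Lemma ideal_addgen_gen P f : ideal (addgen P f) f.
Proof. by apply: ideal_gen; right. Qed.

(** Half of the exchange of two elements of a regular sequence, the half that needs no local or
    graded hypothesis: in [f c = b g] modulo [P], cancelling [g] gives [b = d f], and then
    cancelling [f] gives [c = d g]. *)
Lemma nzd_perm P f g : nzd P f -> nzd (addgen P f) g -> nzd (addgen P g) f.
Proof.
move=> nf ng c /ideal_addgenP[b Ib].
have /ng/ideal_addgenP[d Id] : ideal (addgen P f) (g * b).
  apply/ideal_addgenP; exists c; rewrite -[X in ideal P X]opprK.
  by apply/idealN; rewrite opprB (mulrC c) (mulrC g).
apply/ideal_addgenP; exists d; apply: nf.
have -> : f * (c - d * g) = f * c - b * g + g * (b - d * f) by ring.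
exact/idealD/idealMl.
Qed.

Lemma nzd_ext P Q f : (forall p, ideal P p <-> ideal Q p) -> nzd P f -> nzd Q f.
Proof. by move=> PQ nf c /PQ/nf/PQ. Qed.

End Ideals.

(** * Linear maps given on monomials *)

Section LinearExtension.
Variables (N : nat) (K : fieldType) (V : lmodType K).
Variable h : 'X_{1..N} -> V.

Definition mlin (p : {mpoly K[N]}) : V := \sum_(m <- msupp p) p@_m *: h m.

(** A common degree bound lets several polynomials share one index set, as linearity requires. *)
Lemma mlinwE k p : (msize p <= k)%N -> mlin p = \sum_(m : 'X_{1..N < k}) p@_m *: h m.
Proof.
move=> lt_pk; pose I : subFinType _ := 'X_{1..N < k}.
rewrite /mlin (big_mksub I) //=; first last.
  by move=> x /msize_mdeg_lt /leq_trans; apply.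
  by rewrite msupp_uniq.
by rewrite big_rmcond //= => i; move/memN_msupp_eq0 ->; rewrite scale0r.
Qed.

Lemma mlin_is_linear : linear mlin.
Proof.
move=> c p q /=; pose l := maxn (msize (c *: p + q)) (maxn (msize p) (msize q)).
rewrite (@mlinwE l (_ + _)) ?leq_maxl // (@mlinwE l p) ?leq_max ?leqnn ?orbT //.
rewrite (@mlinwE l q) ?leq_max ?leqnn ?orbT //.
rewrite scaler_sumr -big_split /=; apply: eq_bigr => m _.
by rewrite linearP /= scalerDl scalerA.
Qed.

HB.instance Definition _ :=
  GRing.isLinear.Build K {mpoly K[N]} V _ mlin mlin_is_linear.

Lemma mlinX m : mlin 'X_[m] = h m.
Proof. by rewrite /mlin msuppX big_seq1 mcoeffX eqxx scale1r. Qed.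

End LinearExtension.

Section DivideByVariable.
Variables (N : nat) (K : fieldType).
Implicit Types (p q a b c : {mpoly K[N]}) (P : {mpoly K[N]} -> Prop).

(* Drops the monomials without ['X_k] and divides the others by ['X_k]. *)
Definition dvx (k : 'I_N) : {mpoly K[N]} -> {mpoly K[N]} :=
  mlin (fun m => if m k == 0%N then 0 else 'X_[m - U_(k)]).

HB.instance Definition _ k := GRing.Linear.on (dvx k).

Lemma dvxX k m : dvx k 'X_[m] = if m k == 0%N then 0 else 'X_[m - U_(k)].
Proof. exact: mlinX. Qed.

(* The polynomials not involving ['X_k] act as scalars for [dvx k]. *)
Definition free k p := forall a, dvx k (p * a) = p * dvx k a.

Lemma freeD k p q : free k p -> free k q -> free k (p + q).
Proof. by move=> fp fq a; rewrite !mulrDl linearD /= fp fq. Qed.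

Lemma freeN k p : free k p -> free k (- p).
Proof. by move=> fp a; rewrite !mulNr linearN /= fp. Qed.

Lemma freeM k p q : free k p -> free k q -> free k (p * q).
Proof. by move=> fp fq a; rewrite -!mulrA fp fq. Qed.

Lemma mpoly_ind_lin (T : {mpoly K[N]} -> Prop) :
  T 0 -> (forall (c : K) m p, T p -> T (c *: 'X_[m] + p)) -> forall p, T p.
Proof. by move=> T0 TX; apply: mpolyind => // c m p _ _; exact: TX. Qed.

Lemma freeX k l : k != l -> free k ('X_l).
Proof.
move=> nkl; apply: mpoly_ind_lin => [|c m p IH]; first by rewrite mulr0 linear0 mulr0.
rewrite mulrDr !linearD /= IH mulrDr -scalerAr !linearZ /= -scalerAr; congr (_ *: _ + _).
rewrite -mpolyXD !dvxX mnmDE mnm1E [l == k]eq_sym (negbTE nkl) add0n.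
case: eqP => [|m0]; rewrite ?mulr0 // -mpolyXD; congr 'X_[_].
apply/mnmP => i; rewrite !(mnmDE, mnmBE, mnm1E).
by case: (eqVneq k i) => [<-|]; rewrite ?subn0 // [l == k]eq_sym (negbTE nkl).
Qed.

Lemma dvx_Xmul k a : dvx k ('X_k * a) = a.
Proof.
elim/mpoly_ind_lin: a => [|c m p IH]; first by rewrite mulr0 linear0.
rewrite mulrDr !linearD /= IH -scalerAr !linearZ /= -mpolyXD dvxX mnmDE mnm1E eqxx /=.
by rewrite addmC addmK.
Qed.

Lemma dvx_nilp k c : exists n, iter n (dvx k) c = 0.
Proof.
have it0 n : iter n (dvx k) 0 = 0 by elim: n => //= n ->; rewrite linear0.
have itW n d p : iter n (dvx k) p = 0 -> iter (n + d) (dvx k) p = 0.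
  by rewrite addnC iterD => ->; exact: it0.
have itD n p q : iter n (dvx k) (p + q) = iter n (dvx k) p + iter n (dvx k) q.
  by elim: n => //= n ->; rewrite linearD.
have itZ n s p : iter n (dvx k) (s *: p) = s *: iter n (dvx k) p.
  by elim: n => //= n ->; rewrite linearZ.
elim/mpoly_ind_lin: c => [|s m p [n hn]]; first by exists 0%N.
suff [n' hn'] : exists n', iter n' (dvx k) 'X_[m] = 0.
  exists (n + n')%N; rewrite itD itZ (itW _ _ _ hn) addr0 addnC (itW _ _ _ hn').
  by rewrite scaler0.
move: {2}(m k) (leqnn (m k)) => d; elim: d m => [|d IH] m hm.
  by exists 1%N; rewrite /= dvxX -leqn0 hm.
have [m0|m0] := eqVneq (m k) 0%N; first by exists 1%N; rewrite /= dvxX m0.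
have [|n' hn'] := IH (m - U_(k))%MM; first by rewrite mnmBE mnm1E eqxx leq_subLR.
by exists n'.+1; rewrite iterSr dvxX (negbTE m0).
Qed.

(** [dvx k] is linear over the generators, so it acts on their coefficients only. *)
Lemma ideal_dvx k P p :
  (forall g, P g -> free k g) -> ideal P p -> ideal P (dvx k p).
Proof.
move=> fP; elim=> [|a g q Pg _ IH]; first by rewrite linear0; exact: ideal0.
by rewrite linearD /= mulrC (fP _ Pg) mulrC; exact: ideal_add.
Qed.

(** [dvx k] is a left inverse of the multiplication by ['X_k] and preserves the ideal. *)
Lemma nzd_var k P : (forall g, P g -> free k g) -> nzd P ('X_k).
Proof. by move=> fP c /(ideal_dvx fP); rewrite dvx_Xmul. Qed.

(* The leading coefficient of [a + b 'X_k] in ['X_k] is [b]. *)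
Lemma nzd_linear_in_var k P a b :
  (forall g, P g -> free k g) -> free k a -> free k b ->
  nzd P b -> nzd P (a + b * 'X_k).
Proof.
move=> fP fa fb nb c Ifc.
(* Descending induction: high iterates of [dvx k] on [c] vanish, and each iterate lies in the ideal
   once the next one does. *)
suff all n d : iter (n + d) (dvx k) c = 0 -> ideal P (iter n (dvx k) c).
  by have [n hn] := dvx_nilp k c; exact: (all 0%N n).
elim: d n => [|d IH] n hn; first by rewrite -(addn0 n) hn; exact: ideal0.
apply: nb; have := IH n.+1; rewrite addSnnS => /(_ hn) Ic.
have -> : b * iter n (dvx k) c =
    iter n.+1 (dvx k) ((a + b * 'X_k) * c) - a * iter n.+1 (dvx k) c.
  have E l p q : free k q -> iter l (dvx k) (q * p) = q * iter l (dvx k) p.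
    by move=> fq; elim: l => //= l ->.
  rewrite iterSr mulrDl linearD /= -mulrA fa fb dvx_Xmul.
  have itD l p q : iter l (dvx k) (p + q) = iter l (dvx k) p + iter l (dvx k) q.
    by elim: l => //= l ->; rewrite linearD.
  by rewrite itD !E // -iterSr /= addrAC subrr add0r.
apply/idealB/idealMl => //.
by elim: (n.+1) => //= l; exact: ideal_dvx.
Qed.

(** ['X_k] is regular modulo [P] and [f], so the two can be exchanged. *)
Lemma nzd_addvar k P f :
  (forall g, P g -> free k g) -> free k f -> nzd P f -> nzd (addgen P ('X_k)) f.
Proof.
move=> fP ff nf; apply: nzd_perm => //.
by apply: nzd_var => g [/fP|->].
Qed.

End DivideByVariable.

(** * Cliques with attached forests *)

Section CliqueForest.
Variables (K : fieldType) (n : nat).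
Local Notation S := {mpoly K[n + n]}.
Local Notation edges := (seq ('I_n * 'I_n)).
Implicit Types (P : S -> Prop) (M : {set 'I_n}) (E : edges) (u v z : 'I_n).
Local Notation x := (xv K).
Local Notation y := (yv K).
Local Notation f_ := (@fgen K n).

(** All ordered pairs in [M] are taken, [i = j] included; compared with one generator per edge this
    adds only zeros and opposites. *)
Definition clique_forest M E (p : S) : Prop :=
  (exists i j, [/\ i \in M, j \in M & p = f_ i j]) \/
  (exists2 e, e \in E & p = f_ e.1 e.2).

(** This is the colon by [y_v] of the clique ideal taken modulo [x_v]; see [colon_clique_yv]. *)
Definition vars_forest M E (p : S) : Prop :=
  (exists2 i, i \in M & p = x i) \/ (exists2 e, e \in E & p = f_ e.1 e.2).

Definition vtx (k : 'I_(n + n)) : 'I_n :=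
  match split k with inl i => i | inr i => i end.

Lemma vtx_lshift i : vtx (lshift n i) = i.
Proof. by rewrite /vtx -[lshift n i]/(unsplit (inl i)) unsplitK. Qed.

Lemma vtx_rshift i : vtx (rshift n i) = i.
Proof. by rewrite /vtx -[rshift n i]/(unsplit (inr i)) unsplitK. Qed.

Lemma free_x k i : vtx k != i -> free k (x i).
Proof. by move=> h; apply: freeX; apply: contraNneq h => ->; rewrite vtx_lshift. Qed.

Lemma free_y k i : vtx k != i -> free k (y i).
Proof. by move=> h; apply: freeX; apply: contraNneq h => ->; rewrite vtx_rshift. Qed.

Lemma free_xy i j : free (lshift n i) (y j).
Proof. by apply: freeX; rewrite eq_lrshift. Qed.

Lemma free_yx i j : free (rshift n i) (x j).
Proof. by apply: freeX; rewrite eq_rlshift. Qed.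

Lemma free_fgen k i j : vtx k != i -> vtx k != j -> free k (f_ i j).
Proof.
move=> hi hj; rewrite /fgen; apply: freeD; last apply: freeN.
  by apply: freeM; [exact: free_x | exact: free_y].
by apply: freeM; [exact: free_x | exact: free_y].
Qed.

Definition avoids E u := all (fun e => (u != e.1) && (u != e.2)) E.
Arguments avoids E u : simpl never.

Lemma free_clique_forest M E k p :
  vtx k \notin M -> avoids E (vtx k) -> clique_forest M E p -> free k p.
Proof.
move=> kM /allP kE [[i [j [iM jM ->]]]|[e /kE/andP[h1 h2] ->]].
  by apply: free_fgen; [apply: contraNneq kM => -> | apply: contraNneq kM => ->].
exact: free_fgen.
Qed.

Lemma free_vars_forest M E k p :
  vtx k \notin M -> avoids E (vtx k) -> vars_forest M E p -> free k p.
Proof.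
move=> kM /allP kE [[i iM ->]|[e /kE/andP[h1 h2] ->]].
  by apply: free_x; apply: contraNneq kM => ->.
exact: free_fgen.
Qed.

Lemma free_y_vars_forest M E i p :
  avoids E i -> vars_forest M E p -> free (rshift n i) p.
Proof.
move=> /allP kE [[j jM ->]|[e /kE/andP[h1 h2] ->]]; first exact: free_yx.
by apply: free_fgen; rewrite vtx_rshift.
Qed.

Lemma nzdN P p : nzd P p -> nzd P (- p).
Proof. by move=> np c; rewrite mulNr => /idealN; rewrite opprK => /np. Qed.

(** The binomial is linear in [y_u] with leading coefficient [x_z], and [y_u] is new. *)
Lemma nzd_leaf_x P z u : (forall p, P p -> free (rshift n u) p) ->
  z != u -> nzd P (x z) -> nzd P (f_ z u).
Proof.
move=> fP zu nx; have -> : f_ z u = - (x u * y z) + x z * 'X_(rshift n u).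
  by rewrite /fgen -/(yv K u) addrC.
apply: nzd_linear_in_var => //; last exact: free_yx.
apply/freeN/freeM; first exact: free_yx.
by apply: free_y; rewrite vtx_rshift eq_sym.
Qed.

Lemma nzd_leaf_y P z u : (forall p, P p -> free (lshift n u) p) ->
  z != u -> nzd P (y z) -> nzd P (f_ z u).
Proof.
move=> fP zu ny; have -> : f_ z u = x z * y u + (- y z) * 'X_(lshift n u).
  by rewrite /fgen -/(xv K u) mulNr (mulrC (y z)).
apply: nzd_linear_in_var => //; last exact: nzdN; last exact/freeN/free_xy.
apply: freeM; last exact: free_xy.
by apply: free_x; rewrite vtx_lshift eq_sym.
Qed.

(** Regularity passes from the attaching vertex to the new leaf: [x_u] is regular modulo [P], the
    binomial is then regular because [x_z] remains so, and the two are exchanged. *)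
Lemma nzd_new_x P z u : (forall p, P p -> free (lshift n u) p) ->
  (forall p, P p -> free (rshift n u) p) ->
  z != u -> nzd P (x z) -> nzd (addgen P (f_ z u)) (x u).
Proof.
move=> fx fy zu nx; apply: nzd_perm; first exact: nzd_var.
apply: nzd_leaf_x => // [p [/fy //|->]|]; first exact: free_yx.
by apply: nzd_addvar => //; apply: free_x; rewrite vtx_lshift eq_sym.
Qed.

Lemma nzd_new_y P z u : (forall p, P p -> free (lshift n u) p) ->
  (forall p, P p -> free (rshift n u) p) ->
  z != u -> nzd P (y z) -> nzd (addgen P (f_ z u)) (y u).
Proof.
move=> fx fy zu ny; apply: nzd_perm; first exact: nzd_var.
apply: nzd_leaf_y => // [p [/fx //|->]|]; first exact: free_xy.
by apply: nzd_addvar => //; apply: free_y; rewrite vtx_rshift eq_sym.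
Qed.

Lemma clique_forest_cons M E z u p :
  ideal (clique_forest M ((z, u) :: E)) p <->
  ideal (addgen (clique_forest M E) (f_ z u)) p.
Proof.
split; apply: ideal_sub => g.
  case=> [h|[e]]; first by apply: ideal_gen; left; left.
  rewrite inE => /orP[/eqP-> ->|eE ->]; apply: ideal_gen; first by right.
  by left; right; exists e.
case=> [[h|[e eE ->]]|->]; apply: ideal_gen; first by left.
  by right; exists e; rewrite // inE eE orbT.
by right; exists (z, u); rewrite // inE eqxx.
Qed.

Lemma vars_forest_cons M E z u p :
  ideal (vars_forest M ((z, u) :: E)) p <->
  ideal (addgen (vars_forest M E) (f_ z u)) p.
Proof.
split; apply: ideal_sub => g.
  case=> [h|[e]]; first by apply: ideal_gen; left; left.
  rewrite inE => /orP[/eqP-> ->|eE ->]; apply: ideal_gen; first by right.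
  by left; right; exists e.
case=> [[h|[e eE ->]]|->]; apply: ideal_gen; first by left.
  by right; exists e; rewrite // inE eE orbT.
by right; exists (z, u); rewrite // inE eqxx.
Qed.

(* Monomials of equal image under the Segre parametrization
   [x_i = s a_i], [y_i = t a_i] of the clique on [M]. *)
Definition segre_eq M (m m' : 'X_{1..n + n}) : bool :=
  [&& [forall i, if i \in M
       then (m (lshift n i) + m (rshift n i) == m' (lshift n i) + m' (rshift n i))%N
       else (m (lshift n i) == m' (lshift n i)) && (m (rshift n i) == m' (rshift n i))]
    & (\sum_(i in M) m (lshift n i) == \sum_(i in M) m' (lshift n i))%N].

Lemma segre_refl M m : segre_eq M m m.
Proof. by apply/andP; split=> //; apply/forallP=> i; rewrite !eqxx; case: ifP. Qed.

Lemma segre_sym M : ssrbool.symmetric (segre_eq M).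
Proof.
move=> m m'; rewrite /segre_eq eq_sym; congr andb; apply: eq_forallb => i.
by case: ifP => _; rewrite eq_sym // [X in _ && X]eq_sym.
Qed.

Lemma segre_trans M : transitive (segre_eq M).
Proof.
move=> b a c /andP[/forallP h1 /eqP s1] /andP[/forallP h2 /eqP s2].
rewrite /segre_eq s1 s2 eqxx andbT; apply/forallP => i.
move: (h1 i) (h2 i); case: ifP => _; first by move=> /eqP-> /eqP->.
by move=> /andP[/eqP-> /eqP->] /andP[/eqP-> /eqP->]; rewrite !eqxx.
Qed.

Lemma segre_add M (d a b : 'X_{1..n + n}) :
  segre_eq M (d + a) (d + b) = segre_eq M a b.
Proof.
rewrite /segre_eq; congr andb.
  apply: eq_forallb => i; rewrite !mnmDE; case: ifP => _; last by rewrite !eqn_add2l.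
  by apply/eqP/eqP; lia.
under eq_bigr do rewrite mnmDE.
under [X in _ == X]eq_bigr do rewrite mnmDE.
by rewrite !big_split /= eqn_add2l.
Qed.

Lemma mnm_lrP (m m' : 'X_{1..n + n}) :
  (forall i, m (lshift n i) = m' (lshift n i)) ->
  (forall i, m (rshift n i) = m' (rshift n i)) -> m = m'.
Proof.
move=> hl hr; apply/mnmP => k; rewrite -(splitK k); by case: (split k) => i; [exact: hl | exact: hr].
Qed.

Lemma segre_swap M i j (m : 'X_{1..n + n}) : i \in M -> j \in M ->
  ideal (clique_forest M [::])
    ('X_[U_(lshift n i) + U_(rshift n j) + m] - 'X_[U_(lshift n j) + U_(rshift n i) + m]).
Proof.
move=> iM jM; rewrite !mpolyXD -mulrBl; apply/idealMr/ideal_gen.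
by left; exists i, j.
Qed.

Lemma segre_swap_eq M i j (m : 'X_{1..n + n}) : i \in M -> j \in M ->
  segre_eq M (U_(lshift n i) + U_(rshift n j) + m)%MM (U_(lshift n j) + U_(rshift n i) + m)%MM.
Proof.
move=> iM jM; rewrite ![(_ + m)%MM]addmC segre_add /segre_eq; apply/andP; split.
  apply/forallP => k; rewrite !mnmDE !mnm1E !eq_lshift !eq_rshift !eq_lrshift !eq_rlshift.
  case: ifPn => kM; first by apply/eqP; lia.
  have [/negbTE-> /negbTE->] : i != k /\ j != k by split; apply: contraNneq kM => <-.
  by [].
have E a b : a \in M -> (\sum_(k in M) (U_(lshift n a) + U_(rshift n b))%MM (lshift n k) = 1)%N.
  move=> aM; rewrite (bigD1 a) //= big1 => [|k /andP[_ ka]];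
    rewrite mnmDE !mnm1E eq_lshift eq_rlshift ?eqxx //.
  by rewrite eq_sym (negbTE ka).
by rewrite !E.
Qed.

(** Induction on the total excess [D] of the [x]-exponents of [m] over those of [m']. If [x_i] is in
    excess, equal sums provide some [x_j] in deficit, and swapping [x_i y_j] for [x_j y_i] lowers
    [D]. *)
Lemma segre_ideal M (m m' : 'X_{1..n + n}) :
  segre_eq M m m' -> ideal (clique_forest M [::]) ('X_[m] - 'X_[m']).
Proof.
pose D (m : 'X_{1..n + n}) := (\sum_(i in M) (m (lshift n i) - m' (lshift n i)))%N.
move: {2}(D m) (leqnn (D m)) => d; elim: d m => [|d IH] m hD hs.
  (* Without excess, each [x]-exponent of [m] on [M] is at most that of [m'], and equal sums force
     equality. *)
  suff -> : m = m' by rewrite subrr; exact: ideal0.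
  have le i : i \in M -> (m (lshift n i) <= m' (lshift n i))%N.
    move=> iM; move: hD; rewrite leqn0 sum_nat_eq0 => /forall_inP/(_ i iM).
    by rewrite subn_eq0.
  case/andP: hs => /forallP hs hsum.
  have eqx i : i \in M -> (m (lshift n i) == m' (lshift n i))%N.
    move=> iM; move: hsum; rewrite (leqif_sum (fun k kM => leqif_eq (le k kM))).
    by move=> /forall_inP/(_ i iM).
  by apply: mnm_lrP => i; move: (hs i) (@eqx i); case: ifP => _; lia.
have [i /andP[iM im]|noi] := pickP [pred i | (i \in M) && (m' (lshift n i) < m (lshift n i))%N].
  have [j /andP[jM jm]|noj] := pickP [pred i | (i \in M) && (m (lshift n i) < m' (lshift n i))%N].
    have ij : i != j by apply: contraTneq im => ->; rewrite -leqNgt ltnW.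
    (* The total exponent at [j] is the same in both monomials, so a deficit in [x_j] leaves a
       factor [y_j]. *)
    have yj : (0 < m (rshift n j))%N.
      by case/andP: hs => /forallP/(_ j); rewrite jM => /eqP; lia.
    pose m0 := (m - (U_(lshift n i) + U_(rshift n j)))%MM.
    have Em : m = (U_(lshift n i) + U_(rshift n j) + m0)%MM.
      apply/mnmP => k; rewrite !(mnmDE, mnmBE, mnm1E).
      case: (lshift n i =P k) => [<-|_]; first by rewrite eq_rlshift; lia.
      by case: (rshift n j =P k) => [<-|_]; lia.
    pose m1 := (U_(lshift n j) + U_(rshift n i) + m0)%MM.
    have -> : 'X_[m] - 'X_[m'] = ('X_[m] - 'X_[m1]) + ('X_[m1] - 'X_[m']) :> S by ring.
    apply: idealD; first by rewrite Em; exact: segre_swap.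
    apply: IH; last first.
      by apply: segre_trans hs; rewrite Em segre_sym; exact: segre_swap_eq.
    suff : (D m1 < D m)%N by lia.
    rewrite /D (bigD1 i) //= [X in (_ < X)%N](bigD1 i) //=.
    rewrite -addSn; apply: leq_add.
      rewrite /m1 /m0 !(mnmDE, mnmBE, mnm1E) !eq_lshift eqxx eq_sym (negbTE ij) !eq_rlshift.
      by lia.
    apply: leq_sum => k /andP[kM ki].
    rewrite /m1 /m0 !(mnmDE, mnmBE, mnm1E) !eq_lshift !eq_rlshift [i == k]eq_sym (negbTE ki).
    by case: (j =P k) => [<-|_]; lia.
  have : (\sum_(i in M) m (lshift n i) == \sum_(i in M) m' (lshift n i))%N by case/andP: hs.
  rewrite eq_sym (leqif_sum (fun k kM => leqif_eq _)) => [/forall_inP/(_ i iM)|k kM]; first lia.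
  by rewrite leqNgt; move: (noj k); rewrite /= kM /= => ->.
suff E0 : D m = 0%N by apply: IH => //; rewrite E0.
by apply: big1 => i iM; move: (noi i); rewrite /= iM /=; lia.
Qed.
End CliqueForest.
Arguments avoids {n} E u : simpl never.

Section CliqueForestRegular.
Variables (K : fieldType) (n : nat).
Local Notation S := {mpoly K[n + n]}.
Local Notation edges := (seq ('I_n * 'I_n)).
Implicit Types (P : S -> Prop) (M : {set 'I_n}) (E : edges) (u v z : 'I_n).
Local Notation x := (xv K).
Local Notation y := (yv K).
Local Notation f_ := (@fgen K n).
Local Notation clique_forest := (@clique_forest K n).
Local Notation vars_forest := (@vars_forest K n).

Definition class_sum M (m0 : 'X_{1..n + n}) : S -> K^o :=
  mlin (fun m => (segre_eq M m0 m)%:R : K^o).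
HB.instance Definition _ M m0 := GRing.Linear.on (class_sum M m0).

Lemma class_sumX M m0 m : class_sum M m0 'X_[m] = (segre_eq M m0 m)%:R.
Proof. exact: mlinX. Qed.

Definition class_repr M (m : 'X_{1..n + n}) := choose (segre_eq M m) m.

Lemma class_reprP M m : segre_eq M m (class_repr M m).
Proof. exact/chooseP/segre_refl. Qed.

Lemma class_repr_eq M m m' : segre_eq M m m' -> class_repr M m = class_repr M m'.
Proof.
move=> h; rewrite /class_repr (@eq_choose _ _ (segre_eq M m')); last first.
  move=> a; apply/idP/idP; last exact: segre_trans.
  by apply: segre_trans; rewrite segre_sym.
by apply: choose_id; [rewrite segre_sym | exact: segre_refl].
Qed.

(** The Segre classes form a basis of the quotient. A multiple of a generator cancels within
    classes. Conversely, replacing each monomial by its class representative changes [p] by an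
    element of the ideal and leaves a polynomial [tau p] whose coefficients are the class sums. *)
Lemma clique_class_sumP M p :
  ideal (clique_forest M [::]) p <-> forall m0, class_sum M m0 p = 0.
Proof.
split=> [+ m0|h].
  elim=> [|a g q [[i [j [iM jM ->]]]|[e]] _ IH //]; first exact: linear0.
  rewrite linearD /= IH addr0 {q IH}; elim/mpoly_ind_lin: a => [|c m q IH].
    by rewrite mul0r linear0.
  rewrite mulrDl linearD /= IH addr0 -scalerAl linearZ /= mulrC mulrBl -!mpolyXD.
  rewrite linearB /= !class_sumX.
  have -> : segre_eq M m0 (U_(lshift n i) + U_(rshift n j) + m)%MM
          = segre_eq M m0 (U_(lshift n j) + U_(rshift n i) + m)%MM.
    have sw := @segre_swap_eq n M i j m iM jM.
    apply/idP/idP => h; apply: segre_trans h _ => //.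
    by rewrite segre_sym.
  by rewrite subrr scaler0.
pose tau : S -> S := mlin (fun m => 'X_[class_repr M m]).
have tauD q r : tau (q + r) = tau q + tau r by exact: linearD.
have tauZ c q : tau (c *: q) = c *: tau q by exact: linearZ.
have tauX m : tau 'X_[m] = 'X_[class_repr M m] by exact: mlinX.
have tau0 : tau 0 = 0 by exact: linear0.
have tauE q m0 : (tau q)@_m0 = if m0 == class_repr M m0 then class_sum M m0 q else 0.
  elim/mpoly_ind_lin: q => [|c m q IH]; first by rewrite tau0 mcoeff0 linear0 if_same.
  rewrite tauD tauZ mcoeffD mcoeffZ IH tauX mcoeffX linearD linearZ /= class_sumX.
  have -> : (class_repr M m == m0) = (m0 == class_repr M m0) && segre_eq M m0 m.
    apply/eqP/andP => [<-|[/eqP e h']]; last by rewrite -(class_repr_eq h').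
    split; first by rewrite -(class_repr_eq (class_reprP M m)).
    by rewrite segre_sym class_reprP.
  by case: (m0 == _) => //=; rewrite mulr0 addr0.
have -> : p = p - tau p.
  suff -> : tau p = 0 by rewrite subr0.
  by apply/mpolyP => m; rewrite tauE h mcoeff0 if_same.
elim/mpoly_ind_lin: {h} p => [|c m q IH]; first by rewrite tau0 subr0; exact: ideal0.
rewrite tauD tauZ tauX opprD addrACA -scalerBr -mul_mpolyC.
by apply/idealD/IH/idealMl/segre_ideal/class_reprP.
Qed.

(** Multiplication by [x_v] translates the classes injectively, so the class sums of [p] are among
    those of the product. *)
Lemma nzd_clique M v : nzd (clique_forest M [::]) (x v).
Proof.
move=> p /clique_class_sumP h; apply/clique_class_sumP => m0.
rewrite -[RHS](h (U_(lshift n v) + m0)%MM).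
elim/mpoly_ind_lin: p {h} => [|c m q IH]; first by rewrite mulr0 !linear0.
rewrite mulrDr !linearD /= IH -scalerAr !linearZ /= -mpolyXD !class_sumX.
by rewrite segre_add.
Qed.

(** * Attaching edges one at a time *)

Definition attachable M E z :=
  [&& z \in M & avoids E z] || (if E is e :: _ then z == e.2 else false).

(** [E] lists the attachments with the latest first. Each brings a new vertex [e.2], hung on an
    untouched clique vertex or on the vertex brought just before; hence each clique vertex carries
    at most one path. *)
Fixpoint valid M E : bool :=
  if E is e :: E' then
    [&& valid M E', e.2 \notin M, avoids E' e.2 & attachable M E' e.1]
  else true.

Lemma avoids_cons e E z : avoids (e :: E) z = [&& z != e.1, z != e.2 & avoids E z].
Proof. by rewrite /avoids /= andbA. Qed.

Lemma attachable_neq M E z u : u \notin M -> avoids E u -> attachable M E z -> z != u.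
Proof.
move=> uM uE /orP[/andP[zM _]|]; first by apply: contraNneq uM => <-.
by case: E uE => // e E; rewrite avoids_cons => /and3P[_ ue _] /eqP->; rewrite eq_sym.
Qed.

(** Validity tests membership in the clique only for endpoints of edges of [E]. *)
Lemma valid_subclique M M' E : valid M E ->
  (forall z, z \in M -> ~~ avoids E z -> z \in M') ->
  (forall z, z \in M' -> ~~ avoids E z -> z \in M) -> valid M' E.
Proof.
elim: E => // e E IH /= /and4P[vE eM aE att] h1 h2; apply/and4P; split=> //.
- apply: IH => // z zM az; [apply: h1|apply: h2] => //;
  by move: az; rewrite avoids_cons; apply: contraNN => /and3P[].
- by apply: contraNN eM => /h2; apply; rewrite avoids_cons eqxx andbF.
case/orP: att => [/andP[zM az]|att]; apply/orP; [left|by right].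
by rewrite az andbT; apply: h1 => //; rewrite avoids_cons eqxx.
Qed.

(** At an untouched vertex [y_z] occurs in no generator; along a path, [nzd_new_y] carries the
    property from each vertex to the next. *)
Lemma nzd_y_vars_forest M E z :
  valid M E -> attachable M E z -> nzd (vars_forest M E) (y z).
Proof.
elim: E z => [|[z0 u] E IH] z.
  move=> _; rewrite /attachable orbF => /andP[zM _].
  by apply: nzd_var => p; exact: free_y_vars_forest.
move=> /and4P[/= vE uM uE att] /orP[/andP[zM za]|/= /eqP ->].
  by apply: nzd_var => p; exact: free_y_vars_forest.
apply: (nzd_ext (fun p => iff_sym (vars_forest_cons M E z0 u p))).
apply: nzd_new_y; last exact: IH.
- by move=> p; apply: free_vars_forest; rewrite vtx_lshift.
- by move=> p; apply: free_vars_forest; rewrite vtx_rshift.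
exact: attachable_neq att.
Qed.

Lemma ideal_clique_xv_vars M E v p : v \in M ->
  ideal (addgen (clique_forest M E) (x v)) p -> ideal (vars_forest M E) p.
Proof.
move=> vM; apply: ideal_sub => _ [[[i [j [iM jM ->]]]|[e eE ->]]|->].
- rewrite /fgen; apply: idealB; apply/idealMr/ideal_gen; left; first by exists i.
  by exists j.
- by apply: ideal_gen; right; exists e.
by apply: ideal_gen; left; exists v.
Qed.

(** Modulo [x_v] the generator [f_ i v] becomes [x_i y_v], so every [x_i] is in the colon.
    Conversely, the larger ideal [vars_forest M E] does not involve [y_v], which therefore
    cancels. *)
Lemma colon_clique_yv M E v p : v \in M -> avoids E v ->
  ideal (vars_forest M E) p <-> ideal (addgen (clique_forest M E) (x v)) (y v * p).
Proof.
move=> vM vE; split=> [h|/(ideal_clique_xv_vars vM)]; last first.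
  by apply: (@nzd_var _ _ (rshift n v)) => q; exact: free_y_vars_forest.
rewrite mulrC; elim: h => [|a h q [[i iM ->]|[e eE ->]] _ IH].
- by rewrite mul0r; exact: ideal0.
- rewrite mulrDl -mulrA; apply: idealD IH; apply: idealMl.
  have -> : x i * y v = f_ i v + x v * y i by rewrite /fgen; ring.
  apply/idealD/idealMr/ideal_addgen_gen; apply: ideal_gen; left; left.
  by exists i, v.
rewrite mulrDl -mulrA; apply: idealD IH; apply/idealMl/idealMr.
by apply: ideal_gen; left; right; exists e.
Qed.

Lemma clique_forest_del M E v p : v \in M ->
  ideal (addgen (addgen (clique_forest M E) (x v)) (y v)) p <->
  ideal (addgen (addgen (clique_forest (M :\ v) E) (x v)) (y v)) p.
Proof.
move=> vM; split; apply: ideal_sub => g; last first.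
  case=> [[[]|->]|->].
  - move=> [i [j []]]; rewrite !inE => /andP[_ iM] /andP[_ jM] ->.
    by apply: ideal_gen; left; left; left; exists i, j.
  - by move=> [e eE ->]; apply: ideal_gen; left; left; right; exists e.
  - by apply: ideal_gen; left; right.
  exact: ideal_addgen_gen.
set P1 := addgen (addgen (clique_forest (M :\ v) E) _) _; case=> [[[[i [j [iM jM ->]]]|[e eE ->]]|->]|->].
- have xP : ideal P1 (x v) by apply: ideal_gen; left; right.
  have yP : ideal P1 (y v) by apply: ideal_gen; right.
  have [->|iv] := eqVneq i v.
    by rewrite /fgen; apply: idealB; [exact: (idealMr _ xP)|exact: (idealMl _ yP)].
  have [->|jv] := eqVneq j v.
    by rewrite /fgen; apply: idealB; [exact: (idealMl _ yP)|exact: (idealMr _ xP)].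
  by apply: ideal_gen; left; left; left; exists i, j; rewrite !inE iv jv.
- by apply: ideal_gen; left; left; right; exists e.
- by apply: ideal_gen; left; right.
exact: ideal_addgen_gen.
Qed.

(* The ideal [I] of [clique_forest M E] and [x_v] is the intersection of the
   ideals of the two hypotheses: they are [I + (y_v)] and [I : y_v]. *)
Lemma nzd_mod_xv M E v z u :
  v \in M -> avoids E v ->
  nzd (addgen (addgen (clique_forest (M :\ v) E) (x v)) (y v)) (f_ z u) ->
  nzd (vars_forest M E) (f_ z u) ->
  nzd (addgen (clique_forest M E) (x v)) (f_ z u).
Proof.
set I := addgen (clique_forest M E) _ => vM vE n1 n2 c Ic.
have /ideal_addgenP[g Ig] : ideal (addgen I (y v)) c.
  apply/(clique_forest_del _ _ vM)/n1/(clique_forest_del _ _ vM).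
  exact: ideal_addgenW.
(* It remains to see that [g y_v] is in [I], that is, that [g] is in [I : y_v]. Modulo that colon
   [y_v] cancels, and [y_v g] agrees with [c], which [n2] puts there. *)
rewrite -[c](subrK (g * y v)); apply: idealD => //; rewrite mulrC.
apply/colon_clique_yv => //; apply: (@nzd_var _ _ (rshift n v)) => [p|].
  exact: free_y_vars_forest.
rewrite -/(yv K v) mulrC -[g * _](subKr c); apply: idealB.
  exact/n2/ideal_clique_xv_vars/Ic.
exact: ideal_clique_xv_vars Ig.
Qed.

(** If [z] is the latest leaf, [nzd_new_x] applies. If [z] is an untouched clique vertex, [x_z] is
    exchanged with the latest binomial, whose regularity modulo [x_z] is checked on the two ideals
    of [nzd_mod_xv]; one of them has the clique [M :\ z], so the induction ranges over all [M]. *)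
Lemma nzd_x_clique_forest M E z :
  valid M E -> attachable M E z -> nzd (clique_forest M E) (x z).
Proof.
elim: E M z => [|[z0 u] E IH] M z; first by move=> _ _; exact: nzd_clique.
move=> /and4P[/= vE uM uE att] attz.
have zu := attachable_neq uM uE att.
have fx M' : u \notin M' -> forall p, clique_forest M' E p -> free (lshift n u) p.
  by move=> h p; apply: free_clique_forest; rewrite vtx_lshift.
have fy M' : u \notin M' -> forall p, clique_forest M' E p -> free (rshift n u) p.
  by move=> h p; apply: free_clique_forest; rewrite vtx_rshift.
apply: (nzd_ext (fun p => iff_sym (clique_forest_cons M E z0 u p))).
case/orP: attz => [/andP[zM]|/= /eqP ->]; last first.
  by apply: nzd_new_x; [exact: fx | exact: fy | exact: zu | exact: IH].
rewrite avoids_cons /= => /and3P[zz0 zu' zE].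
apply: nzd_perm; first by apply: IH => //; rewrite /attachable zM zE.
have uM' : u \notin M :\ z by rewrite !inE negb_and uM orbT.
have attz0 : attachable (M :\ z) E z0.
  by case/orP: att => [/andP[h1 h2]|h]; apply/orP; [left; rewrite !inE eq_sym zz0 h1|right].
apply: nzd_mod_xv => //; last first.
  apply: nzd_leaf_y => //; last exact: nzd_y_vars_forest.
  by move=> p; apply: free_vars_forest; rewrite vtx_lshift.
have ff k : vtx k = z -> forall p, clique_forest (M :\ z) E p -> free k p.
  by move=> kz p; apply: free_clique_forest; rewrite kz // !inE eqxx.
have ffz k : vtx k = z -> free k (f_ z0 u) by move=> kz; apply: free_fgen; rewrite kz.
apply: nzd_addvar; last (apply: nzd_addvar).
- move=> p [|->]; first by apply: ff; rewrite vtx_rshift.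
  exact: free_yx.
- by apply: ffz; rewrite vtx_rshift.
- by apply: ff; rewrite vtx_lshift.
- by apply: ffz; rewrite vtx_lshift.
apply: nzd_leaf_x => //; first exact: fy.
apply: IH => //; apply: valid_subclique vE _ _ => w; rewrite !inE.
- by move=> -> aw; rewrite andbT; apply: contraNneq aw => ->.
- by case/andP.
Qed.

Lemma nzd_leaf_clique_forest M E z u :
  valid M ((z, u) :: E) -> nzd (clique_forest M E) (f_ z u).
Proof.
move=> /and4P[/= vE uM uE att]; apply: nzd_leaf_x.
- by move=> p; apply: free_clique_forest; rewrite vtx_rshift.
- exact: attachable_neq att.
exact: nzd_x_clique_forest.
Qed.

Definition with_star M E v (U : seq 'I_n) :=
  clique_forest M ([seq (v, u) | u <- U] ++ E).

Lemma valid_star M E (U : seq 'I_n) :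
  valid M E -> {in U, forall w, avoids E w} -> valid (M :|: [set w in U]) E.
Proof.
move=> vE hU; apply: valid_subclique vE _ _ => w; rewrite !inE; first by move=> ->.
by case/orP => [//|/hU ->].
Qed.

(** The edges from [v] to [M] and to [U] put all binomials on [M] and [U] into the colon.
    Conversely, the ideal of the completed graph contains that of the star, and [u] is a new leaf
    for it, so the binomial at [u] cancels. *)
Lemma colon_star M E v U u c :
  valid M E -> v \in M -> avoids E v -> uniq (u :: U) ->
  {in u :: U, forall w, w \notin M /\ avoids E w} ->
  ideal (with_star M E v U) (f_ v u * c) <->
  ideal (clique_forest (M :|: [set w in U]) E) c.
Proof.
move=> vE vM aE /andP[uU uniqU] hU; set M' := M :|: _.
have vM' : v \in M' by rewrite !inE vM.
have [uM uE] := hU u (mem_head _ _).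
have uM' : u \notin M' by rewrite !inE negb_or uM.
have vu : v != u by apply: contraNneq uM => <-.
have vE' : valid M' E.
  by apply: valid_star => // w wU; have [|_ ->] := hU w; rewrite // inE wU orbT.
split=> [h|].
  apply: (@nzd_leaf_x _ _ (clique_forest M' E) v u) => //.
  - by move=> p; apply: free_clique_forest; rewrite vtx_rshift.
  - by apply: nzd_x_clique_forest => //; rewrite /attachable vM' aE.
  apply: ideal_sub h => g [[i [j [iM jM ->]]]|[e]].
    by apply: ideal_gen; left; exists i, j; rewrite !inE iM jM.
  rewrite mem_cat => /orP[/mapP[w wU ->] ->|eE ->]; apply: ideal_gen.
    by left; exists v, w; rewrite vM' !inE wU orbT.
  by right; exists e.
have fvw w : w \in M' -> ideal (with_star M E v U) (f_ v w).
  rewrite !inE => /orP[wM|wU]; apply: ideal_gen; first by left; exists v, w.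
  by right; exists (v, w); rewrite // mem_cat map_f.
elim=> [|a g p [[i [j [iM jM ->]]]|[e eE ->]] _ IH]; first by rewrite mulr0; exact: ideal0.
  rewrite mulrDr mulrCA; apply: idealD IH; apply: idealMl.
  (* The Plücker relation for the columns [v], [u], [i], [j]. *)
  have -> : f_ v u * f_ i j =
    (y u * x i - x u * y i) * f_ v j - (y u * x j - x u * y j) * f_ v i.
    by rewrite /fgen; ring.
  by apply: idealB; apply: idealMl; exact: fvw.
rewrite mulrDr mulrCA; apply: idealD IH; apply/idealMl/idealMl/ideal_gen.
by right; exists e; rewrite // mem_cat eE orbT.
Qed.
End CliqueForestRegular.

(** * Koszul homology *)

Section Koszul.
Variables (K : fieldType) (n : nat).
Local Notation S := {mpoly K[n + n]}.
Local Notation chain := (kchain K n).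
Implicit Types (P Q : S -> Prop) (c z : chain) (B A : {set 'I_(n + n)}) (f g : S).

Definition before B (k : 'I_(n + n)) := #|[set b in B | (b < k)%N]|.

Lemma before_add B k l : k \notin B -> before (k |: B) l = ((k < l) + before B l)%N.
Proof.
move=> kB; rewrite /before; case: ltnP => kl.
  have -> : [set b in k |: B | (b < l)%N] = k |: [set b in B | (b < l)%N].
    by apply/setP => b; rewrite !inE; case: eqP => [->|_] /=.
  by rewrite cardsU1 !inE (negbTE kB).
rewrite add0n; apply: eq_card => b; rewrite !inE.
by case: eqP => [->|_] //=; rewrite ltnNge kl (negbTE kB).
Qed.

Definition sgn B k : S := (-1) ^+ before B k.

Lemma sgn_sq B k : sgn B k * sgn B k = 1.
Proof. by rewrite -expr2 /sgn sqrr_sign. Qed.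

Lemma sgn_swap B k l : k \notin B -> l \notin B -> k != l ->
  sgn B k * sgn (k |: B) l = - (sgn B l * sgn (l |: B) k).
Proof.
move=> kB lB kl; rewrite /sgn !before_add // !exprD.
rewrite neq_ltn in kl; case/orP: kl => h; rewrite h ltnNge (ltnW h) /= expr0 expr1; ring.
Qed.

Lemma chainB c c' A : (c - c') A = c A - c' A.
Proof. by rewrite !ffunE. Qed.

Lemma kdiffE c B : kdiff c B = \sum_(k | k \notin B) sgn B k * 'X_k * c (k |: B).
Proof. by rewrite ffunE. Qed.

Lemma kdiffD c c' B : kdiff (c + c') B = kdiff c B + kdiff c' B.
Proof.
by rewrite !kdiffE -big_split /=; apply: eq_bigr => k _; rewrite ffunE mulrDr.
Qed.

Lemma kdiffN c B : kdiff (- c) B = - kdiff c B.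
Proof.
by rewrite !kdiffE -sumrN; apply: eq_bigr => k _; rewrite ffunE mulrN.
Qed.

Lemma kdiffB c c' B : kdiff (c - c') B = kdiff c B - kdiff c' B.
Proof. by rewrite kdiffD kdiffN. Qed.

Definition cmul f c : chain := [ffun A : {set 'I_(n + n)} => f * c A].

Lemma cmulE f c A : cmul f c A = f * c A.
Proof. by rewrite ffunE. Qed.

Lemma kdiff_cmul f c B : kdiff (cmul f c) B = f * kdiff c B.
Proof.
by rewrite !kdiffE mulr_sumr; apply: eq_bigr => k _; rewrite cmulE mulrCA.
Qed.

Lemma ideal_kdiff P c : (forall A, ideal P (c A)) -> forall B, ideal P (kdiff c B).
Proof. by move=> h B; rewrite kdiffE; apply: ideal_sum => k _; exact: idealMl. Qed.

(** Terms are paired along the tournament [r] instead of halving the sum, so characteristic two is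
    covered. *)
Lemma antisym_sum0 (I : finType) (F : I -> I -> S) (r : rel I) :
  (forall k l, k != l -> r k l = ~~ r l k) ->
  (forall k, F k k = 0) -> (forall k l, k != l -> F k l = - F l k) ->
  \sum_k \sum_l F k l = 0.
Proof.
move=> tot F0 FN; rewrite pair_big /= (bigID (fun p => r p.1 p.2)) /=.
rewrite [X in X + _](bigID (fun p => p.1 == p.2)) /= [X in X + _ + _]big1; last first.
  by move=> [k l] /= /andP[_ /eqP->].
rewrite [X in _ + X](bigID (fun p => p.1 == p.2)) /= [X in _ + (X + _)]big1; last first.
  by move=> [k l] /= /andP[_ /eqP->].
rewrite !add0r [X in _ + X](reindex_inj (h := fun p => (p.2, p.1))) /=; last first.
  by move=> [a b] [a' b'] /= [-> ->].
have E p : ~~ r p.2 p.1 && (p.2 != p.1) = r p.1 p.2 && (p.1 != p.2) :> bool.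
  by rewrite [p.2 == _]eq_sym; case: (eqVneq p.1 p.2) => [->|h]; rewrite ?andbF // !andbT -tot.
rewrite [X in _ + X](eq_bigl _ _ E) -big_split /=; apply: big1 => [[k l]] /= /andP[_ kl].
by rewrite (FN _ _ kl) addNr.
Qed.

Lemma kdiff_kdiff c B : kdiff (kdiff c) B = 0.
Proof.
pose F k l : S := if [&& k \notin B, l \notin B & k != l]
  then sgn B k * sgn (k |: B) l * ('X_k * 'X_l) * c (l |: (k |: B)) else 0.
transitivity (\sum_k \sum_l F k l).
  rewrite kdiffE big_mkcond; apply: eq_bigr => k _; rewrite /F.
  case: ifP => kB /=; last by rewrite big1.
  rewrite kdiffE mulr_sumr big_mkcond; apply: eq_bigr => l _.
  rewrite !inE negb_or [l == k]eq_sym andbC; case: ifP => // _; ring.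
apply: (@antisym_sum0 _ F (fun k l => (k < l)%N)) => [k l kl|k|k l kl].
- by rewrite -leqNgt ltn_neqAle (_ : (k != l :> nat) = true).
- by rewrite /F eqxx !andbF.
rewrite /F [l == k]eq_sym kl !andbT andbC; case: ifP => [/andP[lB kB]|_]; last by rewrite oppr0.
rewrite (sgn_swap kB lB kl) setUCA; ring.
Qed.

Lemma homog0 d : (0 : S) \is d.-homog. Proof. exact: dhomog0. Qed.

(** The bound [i <= j] guards the truncated difference [j - i], the degree of the coefficients. *)
Definition in_deg i j A := (#|A| == i) && (i <= j)%N.

Lemma kdegP i j c : kdeg i j c <->
  forall A, if in_deg i j A then is_true (c A \is (j - i).-homog) else c A = 0.
Proof.
split=> h A.
  case: (h A) => [->|[<- [d [<- hd]]]]; first by case: ifP => _ //; exact: homog0.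
  by rewrite /in_deg eqxx leq_addr /= addKn.
have := h A; rewrite /in_deg; case: ifP => [/andP[/eqP <- ij] hd|_ ->]; last by left.
by right; split=> //; exists (j - #|A|)%N; rewrite subnKC.
Qed.

Lemma kdegD i j c c' : kdeg i j c -> kdeg i j c' -> kdeg i j (c + c').
Proof.
move=> /kdegP h /kdegP h'; apply/kdegP => A; rewrite ffunE; move: (h A) (h' A).
by case: ifP => _; [exact: rpredD | move=> -> ->; rewrite addr0].
Qed.

Lemma kdegN i j c : kdeg i j c -> kdeg i j (- c).
Proof.
move=> /kdegP h; apply/kdegP => A; rewrite ffunE; move: (h A).
by case: ifP => _; [rewrite rpredN | move=> ->; rewrite oppr0].
Qed.

Lemma kdegB i j c c' : kdeg i j c -> kdeg i j c' -> kdeg i j (c - c').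
Proof. by move=> h h'; apply/kdegD/kdegN. Qed.

Lemma kdeg_cmul i j e f c : f \is e.-homog -> kdeg i j c -> kdeg i (j + e) (cmul f c).
Proof.
move=> hf /kdegP h; apply/kdegP => A; rewrite cmulE; move: (h A); rewrite /in_deg.
case: eqP => _ /=; last by move=> ->; rewrite mulr0.
case: leqP => ij; last by move=> ->; rewrite mulr0; case: ifP => // _; exact: homog0.
rewrite (leq_trans ij (leq_addr _ _)) => hc.
by rewrite addnC -addnBA //; exact: dhomogM.
Qed.

Lemma homogX k : ('X_k : S) \is 1.-homog.
Proof. by rewrite dhomogX /= mdeg1. Qed.

Lemma kdeg_kdiff i j c : kdeg i.+1 j c -> kdeg i j (kdiff c).
Proof.
move=> /kdegP h; apply/kdegP => B; rewrite kdiffE.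
case: ifP => [/andP[/eqP Bi ij]|hB].
  apply: rpred_sum => k kB; have := h (k |: B); rewrite /in_deg cardsU1 kB Bi eqxx /=.
  case: ltnP => [ij' hc|_ ->]; last by rewrite mulr0 homog0.
  rewrite -mulrA /sgn -signr_odd mulr_sign; case: (odd _); rewrite ?rpredN;
  have -> : (j - i = 1 + (j - i.+1))%N by lia.
    by apply: dhomogM => //; exact: homogX.
  by apply: dhomogM => //; exact: homogX.
apply: big1 => k kB; have := h (k |: B); rewrite /in_deg cardsU1 kB add1n eqSS.
case: ifP => [/andP[Bi ij]|_ ->]; last by rewrite mulr0.
by move: hB; rewrite /in_deg Bi (ltnW ij).
Qed.

(** * Homogeneous components of ideals and chains *)

Lemma pihomogM d e g p : g \is e.-homog ->
  pihomog mdeg d (g * p) = if (e <= d)%N then g * pihomog mdeg (d - e) p else 0 :> S.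
Proof.
move=> hg; elim/mpoly_ind_lin: p => [|c m p IH].
  by rewrite !mulr0 !pihomog0 mulr0 if_same.
rewrite mulrDr !pihomogD IH -scalerAr !linearZ /= pihomogX.
have hgm : g * 'X_[m] \is (e + mdeg m).-homog.
  by apply: dhomogM => //; rewrite dhomogX.
have [ed|ed] := leqP e d; last first.
  by rewrite (pihomog_ne0 _ hgm) ?scaler0 ?addr0 //; lia.
rewrite mulrDr; congr (_ + _); case: eqP => /= hm.
  have E : d = (e + mdeg m)%N by rewrite hm subnKC.
  by rewrite pihomog_dE -?scalerAr // E.
by rewrite (pihomog_ne0 _ hgm) ?scaler0 ?mulr0 //; apply/eqP => E; apply: hm; lia.
Qed.

Definition homgens P := forall g, P g -> exists d, g \is d.-homog.

Lemma ideal_pihomog P d p : homgens P -> ideal P p -> ideal P (pihomog mdeg d p).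
Proof.
move=> hP; elim=> [|a g q Pg _ IH]; first by rewrite pihomog0; exact: ideal0.
have [e hg] := hP _ Pg; rewrite pihomogD; apply: idealD IH; rewrite mulrC (pihomogM _ _ hg).
by case: ifP => _; [rewrite mulrC; exact/idealMl/ideal_gen | exact: ideal0].
Qed.

Lemma homgens_addgen P f e : f \is e.-homog -> homgens P -> homgens (addgen P f).
Proof. by move=> hf hP g [/hP //|->]; exists e. Qed.

Definition cproj i j c : chain :=
  [ffun A : {set 'I_(n + n)} => if in_deg i j A then pihomog mdeg (j - i) (c A) else 0].

Lemma cprojE i j c A : cproj i j c A =
  if in_deg i j A then pihomog mdeg (j - i) (c A) else 0.
Proof. by rewrite ffunE. Qed.

Lemma kdeg_cproj i j c : kdeg i j (cproj i j c).
Proof. by apply/kdegP => A; rewrite cprojE; case: in_deg => //; exact: pihomogP. Qed.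

Lemma cproj_id i j c A : kdeg i j c -> cproj i j c A = c A.
Proof.
by move=> /kdegP /(_ A); rewrite cprojE; case: in_deg => // hc; exact: pihomog_dE.
Qed.

Lemma ideal_cproj P i j c : homgens P ->
  (forall A, ideal P (c A)) -> forall A, ideal P (cproj i j c A).
Proof.
by move=> hP h A; rewrite cprojE; case: ifP => _; [exact: ideal_pihomog | exact: ideal0].
Qed.

Lemma cprojB i j c c' A : cproj i j (c - c') A = cproj i j c A - cproj i j c' A.
Proof. by rewrite !cprojE chainB; case: ifP => _; rewrite ?subr0 // pihomogB. Qed.

Lemma cproj_cmul i j e f c A : f \is e.-homog ->
  cproj i (j + e) (cmul f c) A = f * cproj i j c A.
Proof.
move=> hf; rewrite !cprojE cmulE (pihomogM _ _ hf) /in_deg.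
case: eqP => _ /=; last by rewrite mulr0.
have [ij|ij] := leqP i j.
  rewrite (leq_trans ij (leq_addr _ _)) ifT; last by lia.
  by congr (f * pihomog _ _ _); lia.
by rewrite mulr0; case: ifP => // h; rewrite ifF //; lia.
Qed.

Lemma cproj_cmul_small i j e f c A : f \is e.-homog -> (j < e)%N ->
  cproj i j (cmul f c) A = 0.
Proof.
move=> hf je; rewrite cprojE cmulE (pihomogM _ _ hf).
by case: ifP => // _; rewrite ifF //; lia.
Qed.

Lemma chain_addgen P f c : (forall A, ideal (addgen P f) (c A)) ->
  exists b : chain, forall A, ideal P (c A - f * b A).
Proof.
move=> h; have /fin_all_exists[b hb] : forall A, exists b, ideal P (c A - f * b).
  by move=> A; have /ideal_addgenP[a Ia] := h A; exists a; rewrite mulrC.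
by exists (finfun b) => A; rewrite ffunE.
Qed.

(** A quotient by [f] is chosen at each of the finitely many subsets, then projected to the right
    degree; the ideal is homogeneous, so the congruence survives. *)
Lemma kdeg_addgen P f e i j c : homgens P -> f \is e.-homog -> kdeg i (j + e) c ->
  (forall A, ideal (addgen P f) (c A)) ->
  exists2 b : chain, kdeg i j b & forall A, ideal P (c A - f * b A).
Proof.
move=> hP hf hc /chain_addgen[b hb]; exists (cproj i j b) => [|A]; first exact: kdeg_cproj.
have := @ideal_cproj P i (j + e) (c - cmul f b) hP _ A.
rewrite cprojB cproj_id // cproj_cmul //; apply=> A'.
by rewrite !(chainB, cmulE).
Qed.

Lemma kdeg_addgen_small P f e i j c : homgens P -> f \is e.-homog -> (j < e)%N ->
  kdeg i j c -> (forall A, ideal (addgen P f) (c A)) -> forall A, ideal P (c A).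
Proof.
move=> hP hf je hc /chain_addgen[b hb] A.
have := @ideal_cproj P i j (c - cmul f b) hP _ A.
by rewrite cprojB cproj_id // (cproj_cmul_small _ _ _ hf) // subr0; apply=> A'; rewrite !(chainB, cmulE).
Qed.

(** * Vanishing of Koszul homology and bounds on the regularity *)

Definition kcyc P i j c := kdeg i j c /\ forall B, ideal P (kdiff c B).
Definition kbnd P i j c :=
  kdeg i j c /\ exists c', kdeg i.+1 j c' /\ forall A, ideal P (c A - kdiff c' A).
Definition kvan P i j := forall c, kcyc P i j c -> kbnd P i j c.
Definition reg_le P t := forall i j, (i + t < j)%N -> kvan P i j.

Lemma reg_leW P t t' : (t <= t')%N -> reg_le P t -> reg_le P t'.
Proof. by move=> tt h i j ij; apply: h; lia. Qed.

Lemma reg_le_ext P Q t : (forall p, ideal P p <-> ideal Q p) -> reg_le P t -> reg_le Q t.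
Proof.
move=> PQ h i j ij c [hc hd]; have [|_ [c' [hc' hcc]]] := h i j ij c; first split=> // B.
  exact/PQ.
by split=> //; exists c'; split=> // A; apply/PQ.
Qed.

(* The next two lemmas chase the long exact sequence of
   [0 -> S/(J : f)(-e) -> S/J -> S/(J + f) -> 0]. *)
Lemma kvan_quot P Q f e i j : homgens P -> f \is e.-homog ->
  (forall p, ideal Q p <-> ideal P (f * p)) ->
  kvan P i.+1 (j + e) -> kvan Q i j -> kvan (addgen P f) i.+1 (j + e).
Proof.
move=> hP hf QP vP vQ z [hz dz]; split=> //.
(* [b] represents the image of [z] under the connecting map. *)
have [b hb dzb] := kdeg_addgen hP hf (kdeg_kdiff hz) dz.
have [|_ [b' [hb' bb']]] := vQ b; first split=> // B.
  apply/QP; have := ideal_kdiff (c := kdiff z - cmul f b) _ B.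
  rewrite kdiffB kdiff_kdiff kdiff_cmul sub0r => h.
  by rewrite -[X in ideal _ X]opprK; apply/idealN/h => A; rewrite !(chainB, cmulE); exact: dzb.
(* Subtracting [f b'] makes [z] a cycle modulo [P] and changes nothing modulo [f]. *)
have [|_ [w [hw zw]]] := vP (z - cmul f b'); first split.
- by apply/kdegB/kdeg_cmul.
- move=> B; rewrite kdiffB kdiff_cmul.
  have -> : kdiff z B - f * kdiff b' B = (kdiff z B - f * b B) + f * (b B - kdiff b' B) by ring.
  by apply: idealD; [exact: dzb | exact/QP].
exists w; split=> // A; apply/ideal_addgenP; exists (b' A).
by move: (zw A); rewrite !(chainB, cmulE) addrAC [b' A * f]mulrC.
Qed.

Lemma kvan_sub P Q f e i j : homgens P -> f \is e.-homog ->
  (forall p, ideal Q p <-> ideal P (f * p)) ->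
  kvan Q i j -> kvan (addgen P f) i (j + e) -> kvan P i (j + e).
Proof.
move=> hP hf QP vQ vPf z [hz dz]; split=> //.
have [|_ [w [hw zw]]] := vPf z; first by split=> // B; exact: ideal_addgenW.
have hzw : kdeg i (j + e) (z - kdiff w) by apply/kdegB/kdeg_kdiff.
have [|b hb zwb] := kdeg_addgen hP hf hzw; first by move=> A; rewrite !(chainB, cmulE); move: (zw A).
have [|_ [b' [hb' bb']]] := vQ b; first split=> // B.
  apply/QP; have := ideal_kdiff (c := z - kdiff w - cmul f b) _ B.
  rewrite !kdiffB kdiff_kdiff kdiff_cmul subr0 => h.
  have -> : f * kdiff b B = kdiff z B - (kdiff z B - f * kdiff b B) by ring.
  apply: idealB => //; apply: h => A.
  by move: (zwb A); rewrite !(chainB, cmulE).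
exists (w + cmul f b'); split=> [|A]; first exact/kdegD/kdeg_cmul.
rewrite kdiffD kdiff_cmul.
have -> : z A - (kdiff w A + f * kdiff b' A) =
   (z A - kdiff w A - f * b A) + f * (b A - kdiff b' A) by ring.
apply: idealD; last exact/QP.
by move: (zwb A); rewrite !(chainB, cmulE).
Qed.

Definition wedge k c : chain :=
  [ffun A : {set 'I_(n + n)} => if k \in A then sgn (A :\ k) k * c (A :\ k) else 0].

Lemma wedgeE k c A :
  wedge k c A = if k \in A then sgn (A :\ k) k * c (A :\ k) else 0.
Proof. by rewrite ffunE. Qed.

(* [e_k /\ -] is a contracting homotopy for the multiplication by ['X_k]. *)
Lemma kdiff_wedge k c B : kdiff (wedge k c) B + wedge k (kdiff c) B = 'X_k * c B.
Proof.
rewrite kdiffE [wedge k _ B]wedgeE; case: ifPn => kB.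
  have -> : B = k |: (B :\ k) by rewrite setD1K.
  move: (B :\ k) (setD11 k B) => B' kB' {B kB}; rewrite setU1K ?kB' //.
  rewrite kdiffE [X in _ + _ * X](bigD1 k) ?kB' //= mulrDr.
  rewrite [X in _ + (X + _)]mulrA [X in _ + (X * _ + _)]mulrA sgn_sq mul1r addrCA.
  rewrite -[RHS]addr0; congr (_ + _); rewrite mulr_sumr.
  have E l : (l \notin k |: B') = (l \notin B') && (l != k) by rewrite !inE negb_or andbC.
  rewrite (eq_bigl _ _ E) -big_split /=; apply: big1 => l /andP[lB lk].
  rewrite wedgeE !inE eqxx orbT /=.
  have -> : (l |: (k |: B')) :\ k = l |: B'.
    by rewrite setUCA setU1K // !inE negb_or eq_sym lk kB'.
  have -> : sgn (k |: B') l * 'X_l * (sgn (l |: B') k * c (l |: B')) =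
    sgn (l |: B') k * sgn (k |: B') l * ('X_l * c (l |: B')) by ring.
  have kB'' : k \notin B' by rewrite kB'.
  have := congr1 (fun t => sgn (l |: B') k * t * sgn B' k) (sgn_swap kB'' lB _).
  rewrite eq_sym => /(_ lk).
  have -> : sgn (l |: B') k * (sgn B' k * sgn (k |: B') l) * sgn B' k
    = sgn (l |: B') k * sgn (k |: B') l * (sgn B' k * sgn B' k) by ring.
  rewrite sgn_sq mulr1 => ->.
  have -> : sgn (l |: B') k * - (sgn B' l * sgn (l |: B') k) * sgn B' k =
    - (sgn (l |: B') k * sgn (l |: B') k) * (sgn B' k * sgn B' l) by ring.
  rewrite sgn_sq; ring.
rewrite addr0 (bigD1 k) //= big1 => [|l /andP[lB lk]].
  rewrite addr0 wedgeE setU11 setU1K //.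
  have -> : sgn B k * 'X_k * (sgn B k * c B) = (sgn B k * sgn B k) * ('X_k * c B) by ring.
  by rewrite sgn_sq mul1r.
by rewrite wedgeE !inE eq_sym (negbTE lk) (negbTE kB) mulr0.
Qed.

Lemma ideal_wedge P k c : (forall A, ideal P (c A)) -> forall A, ideal P (wedge k c A).
Proof. by move=> h A; rewrite wedgeE; case: ifP => _; [exact: idealMl|exact: ideal0]. Qed.

Lemma kdeg_wedge i j k c : kdeg i j c -> kdeg i.+1 j.+1 (wedge k c).
Proof.
move=> /kdegP h; apply/kdegP => A; rewrite wedgeE /in_deg ltnS subSS.
case: (boolP (k \in A)) => kA; last by case: ifP => // _; exact: homog0.
have := h (A :\ k); rewrite /in_deg (cardsD1 k A) kA add1n eqSS.
case: ifP => [_ hc|_ ->]; last by rewrite mulr0.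
by rewrite /sgn -signr_odd mulr_sign; case: (odd _); rewrite ?rpredN.
Qed.

(** As ['X_k] kills Koszul homology, the homology modulo [P] injects into that modulo [P] and
    ['X_k]: if [z - dw] is ['X_k b], then [b] is a cycle by regularity, and ['X_k b] is the boundary
    of the wedge of [e_k] with [b]. *)
Lemma kbnd_mod_var P k i j z : homgens P -> nzd P ('X_k) ->
  kcyc P i j z -> kbnd (addgen P ('X_k)) i j z -> kbnd P i j z.
Proof.
move=> hP nk [hz dz] [_ [w [hw zw]]]; split=> //.
have hzw : kdeg i j (z - kdiff w) by apply/kdegB/kdeg_kdiff.
have zw' A : ideal (addgen P ('X_k)) ((z - kdiff w) A).
  by move: (zw A); rewrite !(chainB, cmulE).
(* In total degree 0 there is no room for a multiple of ['X_k]. *)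
case: j => [|j] in hz hw hzw *.
  exists w; split=> // A; have := kdeg_addgen_small hP (homogX k) (ltnSn 0) hzw zw' A.
  by rewrite !(chainB, cmulE).
rewrite -addn1 in hzw; have [b hb zwb] := kdeg_addgen hP (homogX k) hzw zw'.
exists (w + wedge k b); split=> [|A]; first exact/kdegD/kdeg_wedge.
have db B : ideal P (kdiff b B).
  apply: nk; have := ideal_kdiff (c := z - kdiff w - cmul ('X_k) b) _ B.
  rewrite !kdiffB kdiff_kdiff kdiff_cmul subr0 => h.
  have -> : 'X_k * kdiff b B = kdiff z B - (kdiff z B - 'X_k * kdiff b B) by ring.
  by apply: idealB => //; apply: h => A'; move: (zwb A'); rewrite !(chainB, cmulE).
rewrite kdiffD.
have -> : z A - (kdiff w A + kdiff (wedge k b) A) =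
   (z A - kdiff w A - 'X_k * b A) + wedge k (kdiff b) A.
  by rewrite -(kdiff_wedge k b A); ring.
by apply: idealD; [move: (zwb A); rewrite !(chainB, cmulE) | exact: ideal_wedge].
Qed.

(** The connecting map lowers the homological degree by one, so the colon contributes its regularity
    plus [e - 1]. *)
Lemma reg_le_quot P Q f e t t' : homgens P -> f \is e.-homog ->
  (forall p, ideal Q p <-> ideal P (f * p)) ->
  (t' + e <= t.+1)%N -> reg_le P t -> reg_le Q t' -> reg_le (addgen P f) t.
Proof.
move=> hP hf QP te rP rQ [|i] j ij.
  (* In homological degree 0 there is no connecting map: every chain is already a cycle modulo
     [P]. *)
  move=> z [hz _]; have [|_ [w [hw zw]]] := rP 0%N j ij z.
    split=> // B; rewrite kdiffE big1 => [|k kB]; first exact: ideal0.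
    move/kdegP: hz => /(_ (k |: B)); rewrite /in_deg cardsU1 kB /= => ->; exact: mulr0.
  by split=> //; exists w; split=> // A; exact: ideal_addgenW.
have -> : j = (j - e + e)%N by lia.
by apply: (kvan_quot hP hf QP); [apply: rP | apply: rQ]; lia.
Qed.

(** Here the colon enters as a shifted submodule in the same homological degree, so it contributes
    its regularity plus [e]. *)
Lemma reg_le_sub P Q f e t t' : homgens P -> f \is e.-homog ->
  (forall p, ideal Q p <-> ideal P (f * p)) ->
  (t' + e <= t)%N -> reg_le Q t' -> reg_le (addgen P f) t -> reg_le P t.
Proof.
move=> hP hf QP te rQ rP i j ij.
have -> : j = (j - e + e)%N by lia.
by apply: (kvan_sub hP hf QP); [apply: rQ | apply: rP]; lia.
Qed.

(** The case in which the colon is the ideal itself: a regular quadric costs one, a regular linear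
    form nothing. *)
Lemma reg_le_nzd P f e t : homgens P -> f \is e.-homog -> nzd P f ->
  reg_le P t -> reg_le (addgen P f) (t + e.-1).
Proof.
move=> hP hf nf rP; apply: (reg_le_quot hP hf (Q := P) (t' := t)).
- by move=> p; split; [exact: idealMl | exact: nf].
- lia.
- by apply: reg_leW rP; lia.
- exact: rP.
Qed.

Lemma reg_le_var P k t : homgens P -> nzd P ('X_k) ->
  reg_le (addgen P ('X_k)) t -> reg_le P t.
Proof.
move=> hP nk rP i j ij z hz; apply: (kbnd_mod_var hP nk hz); apply: rP => //.
by case: hz => hz dz; split=> // B; exact: ideal_addgenW.
Qed.

(** * Nonzero Koszul classes *)

Definition knontriv P i j := exists z, kcyc P i j z /\ ~ kbnd P i j z.

(* Since [f] kills the Koszul homology of [P], every class modulo [P] lifts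
   to a class modulo [P] and [f], one homological degree higher. *)
Lemma knontriv_nzd P a b g h e i j :
  homgens P -> g \is e.-homog -> h \is e.-homog ->
  nzd P ('X_a * g + 'X_b * h) -> knontriv P i j ->
  knontriv (addgen P ('X_a * g + 'X_b * h)) i.+1 (j + e.+1).
Proof.
move=> hP hg hh; set f := _ + _ => nf [z [[hz dz] nz]].
have hf : f \is e.+1.-homog.
  by apply: rpredD; rewrite -add1n; apply: dhomogM => //; exact: homogX.
(* By the contracting homotopies of ['X_a] and ['X_b], the differential of [w] is [f z] modulo
   [P]. *)
pose w := cmul g (wedge a z) + cmul h (wedge b z).
have dw B : ideal P (f * z B - kdiff w B).
  have -> : f * z B - kdiff w B = g * wedge a (kdiff z) B + h * wedge b (kdiff z) B.
    rewrite kdiffD !kdiff_cmul.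
    have -> : f * z B = g * ('X_a * z B) + h * ('X_b * z B) by rewrite /f; ring.
    rewrite -!kdiff_wedge; ring.
  by apply: idealD; apply: idealMl; exact: ideal_wedge.
have hw : kdeg i.+1 (j + e.+1) w.
  by rewrite -addSnnS; apply: kdegD; apply: kdeg_cmul => //; exact: kdeg_wedge.
exists w; split.
  split=> // B; rewrite -[kdiff w B](subKr (f * z B)); apply: idealB.
    by apply/idealMr/ideal_addgen_gen.
  exact: ideal_addgenW.
(* If [w - dw'] is [f d] modulo [P], applying the differential and cancelling [f] would make [z] the
   boundary of [d]. *)
case=> _ [w' [hw' ww']]; apply: nz; split=> //.
have hd : kdeg i.+1 (j + e.+1) (w - kdiff w') by apply/kdegB/kdeg_kdiff.
have [|d hdd wd] := kdeg_addgen hP hf hd; first by move=> A; move: (ww' A); rewrite !(chainB, cmulE).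
exists d; split=> // A; apply: nf.
have := ideal_kdiff (c := w - kdiff w' - cmul f d) _ A.
rewrite !kdiffB kdiff_kdiff kdiff_cmul subr0 => hI.
have -> : f * (z A - kdiff d A) = (f * z A - kdiff w A) + (kdiff w A - f * kdiff d A) by ring.
by apply: idealD => //; apply: hI => B; move: (wd B); rewrite !(chainB, cmulE).
Qed.

Definition addvars P (s : seq 'I_(n + n)) := foldr (fun k Q => addgen Q ('X_k)) P s.

Lemma homgens_addvars P s : homgens P -> homgens (addvars P s).
Proof. by move=> hP; elim: s => //= k s IH; exact: homgens_addgen (homogX k) IH. Qed.

Lemma ideal_addvarsW P s p : ideal P p -> ideal (addvars P s) p.
Proof. by move=> h; elim: s => //= k s; exact: ideal_addgenW. Qed.

Lemma ideal_addvars_var P s k : k \in s -> ideal (addvars P s) ('X_k).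
Proof.
elim: s => //= l s IH; rewrite inE => /orP[/eqP ->|/IH]; first exact: ideal_addgen_gen.
exact: ideal_addgenW.
Qed.

Lemma free_addvars P s k : k \notin s -> (forall p, P p -> free k p) ->
  forall p, addvars P s p -> free k p.
Proof.
move=> + fP; elim: s => //= l s IH; rewrite inE negb_or => /andP[kl /IH h] p [/h //|->].
exact: freeX.
Qed.

(** [Q] lies between [P] and [P] with new variables added. A chain bounding the class modulo [Q]
    bounds it modulo the larger ideal, and the variables are then removed one by one with
    [kbnd_mod_var]. *)
Lemma knontriv_addvars P Q s i j : homgens P -> uniq s ->
  {in s, forall k p, P p -> free k p} ->
  (forall p, P p -> ideal Q p) -> (forall p, Q p -> ideal (addvars P s) p) ->
  knontriv P i j -> knontriv Q i j.
Proof.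
move=> hP us fP PQ QP [z [[hz dz] nz]]; exists z; split.
  by split=> // B; apply: ideal_sub (dz B).
case=> _ [w [hw zw]]; apply: nz.
have : kbnd (addvars P s) i j z.
  by split=> //; exists w; split=> // A; apply: ideal_sub (zw A).
elim: s us fP {QP} => //= k s IH /andP[ks us] fP h; apply: IH => //.
  by move=> l ls; apply: fP; rewrite inE ls orbT.
apply: kbnd_mod_var h.
- exact: homgens_addvars.
- by apply: nzd_var; apply: free_addvars => // p; apply: fP; rewrite inE eqxx.
by split=> // B; exact: ideal_addvarsW.
Qed.

(** The class of 1: a bounding chain would have homological degree 1 and total degree 0, hence be
    zero. *)
Lemma knontriv_zero : knontriv (fun _ : S => False) 0 0.
Proof.
have I0 p : ideal (fun _ : S => False) p -> p = 0 by elim.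
pose z : chain := [ffun A : {set 'I_(n + n)} => if A == set0 then 1 else 0].
have hz : kdeg 0 0 z.
  apply/kdegP => A; rewrite ffunE /in_deg cards_eq0 andbT.
  by case: eqP => _ /=; [exact: dhomog1 | ].
exists z; split.
  split=> // B; rewrite kdiffE big1 ?ideal0 // => [|k kB]; first exact: ideal0.
  by rewrite ffunE -cards_eq0 cardsU1 kB mulr0.
case=> _ [w [/kdegP hw /(_ set0)/I0]]; rewrite ffunE eqxx kdiffE big1 => [|k _].
  by rewrite subr0 => /eqP; rewrite oner_eq0.
by have := hw (k |: set0); rewrite /in_deg andbF => ->; rewrite mulr0.
Qed.

End Koszul.

(** * Regularity of the ideals *)

Section Regularity.
Variables (K : fieldType) (n : nat).
Local Notation S := {mpoly K[n + n]}.
Local Notation edges := (seq ('I_n * 'I_n)).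
Implicit Types (P : S -> Prop) (M : {set 'I_n}) (E : edges) (u v z : 'I_n).
Local Notation x := (xv K).
Local Notation y := (yv K).
Local Notation f_ := (@fgen K n).
Local Notation clique_forest := (@clique_forest K n).
Local Notation vars_forest := (@vars_forest K n).
Local Notation with_star := (@with_star K n).

Definition vars_in (T : {set 'I_(n + n)}) (p : S) : Prop := exists2 k, k \in T & p = 'X_k.

Lemma homgens_vars_in T : homgens (vars_in T).
Proof. by move=> g [k _ ->]; exists 1%N; exact: homogX. Qed.

Lemma homog_in_maximal_ideal (p : S) d : p \is d.-homog -> (0 < d)%N ->
  ideal (vars_in setT) p.
Proof.
move=> /dhomogP hp d0; rewrite [p]mpolyE big_seq; apply: ideal_sum => m mp.
rewrite -mul_mpolyC; apply: idealMl.
have [k mk|m0] := pickP [pred k | (0 < m k)%N]; last first.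
  have := hp _ mp => /= md; move: d0; rewrite -md mdegE big1 // => i _.
  by apply/eqP; rewrite -leqn0 leqNgt; move: (m0 i) => /= ->.
have -> : m = (U_(k) + (m - U_(k)))%MM.
  apply/mnmP => i; rewrite !(mnmDE, mnmBE, mnm1E); move: mk => /=.
  by case: (k =P i) => [<-|_]; lia.
by rewrite mpolyXD; apply/idealMr/ideal_gen; exists k.
Qed.

(** Induction on the number of missing variables, each of them regular. When none is missing,
    coefficients of positive degree already lie in the ideal, so the zero chain serves as
    witness. *)
Lemma reg_vars_in T : reg_le (vars_in T) 0.
Proof.
move: {2}#|~: T| (leqnn #|~: T|) => d; elim: d T => [|d IH] T hd.
  have -> : T = setT.
    apply/setP => k; move: hd; rewrite leqn0 cards_eq0 => /eqP/setP/(_ k).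
    by rewrite !inE => /negbFE ->.
  move=> i j; rewrite addn0 => ij z [hz dz]; split=> //; exists 0; split.
    by move=> A; left; rewrite ffunE.
  move=> A; rewrite kdiffE big1 ?subr0 => [|k _]; last by rewrite ffunE mulr0.
  move/kdegP: hz => /(_ A); case: in_deg => [hA|->]; last exact: ideal0.
  by apply: homog_in_maximal_ideal hA _; rewrite subn_gt0.
have [k kT|allT] := pickP [pred k | k \notin T]; last first.
  apply: IH; suff -> : ~: T = set0 by rewrite cards0.
  by apply/setP => k; rewrite !inE; move: (allT k) => /= ->.
apply: (@reg_le_var _ _ _ k); first exact: homgens_vars_in.
  by apply: nzd_var => p [l lT ->]; apply: freeX; apply: contraNneq kT => ->.
apply: (@reg_le_ext _ _ (vars_in (k |: T))); last first.
  apply: IH; rewrite -ltnS (leq_trans _ hd) // proper_card //.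
  rewrite properC properE subsetUr /=; apply: contraNN kT => /subsetP/(_ k).
  by rewrite !inE eqxx => ->.
move=> p; split; apply: ideal_sub => g.
  move=> [l]; rewrite !inE => /orP[/eqP-> ->|lT ->]; first exact: ideal_addgen_gen.
  by apply/ideal_addgenW/ideal_gen; exists l.
by case=> [[l lT ->]|->]; apply: ideal_gen; [exists l|exists k]; rewrite // !inE ?lT ?eqxx ?orbT.
Qed.

Lemma reg_vars_forest M : reg_le (vars_forest M [::]) 0.
Proof.
apply: (@reg_le_ext _ _ (vars_in [set lshift n i | i in M])); last exact: reg_vars_in.
move=> p; split; apply: ideal_sub => g.
  by move=> [k /imsetP[i iM ->] ->]; apply: ideal_gen; left; exists i.
by case=> [[i iM ->]|[]//]; apply: ideal_gen; exists (lshift n i); rewrite ?imset_f.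
Qed.

Lemma homog_fgen i j : f_ i j \is 2.-homog.
Proof. by apply: rpredB; rewrite -[2%N]/(1 + 1)%N; apply: dhomogM; exact: homogX. Qed.

Lemma homgens_clique_forest M E : homgens (clique_forest M E).
Proof. by move=> g [[i [j [_ _ ->]]]|[e _ ->]]; exists 2%N; exact: homog_fgen. Qed.

(** Induction on the clique. After the regular [x_v], the colon by [y_v] has regularity 0 and
    contributes 1, while adding [y_v] leaves the clique without [v] and two new variables. *)
Lemma reg_clique M : reg_le (clique_forest M [::]) 1.
Proof.
move: {2}#|M| (leqnn #|M|) => d; elim: d M => [|d IH] M hM.
  apply: (@reg_leW _ _ _ 0) => //.
  apply: (@reg_le_ext _ _ (vars_forest M [::])); last exact: reg_vars_forest.
  move=> p.
  move: hM; rewrite leqn0 cards_eq0 => /eqP ->.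
  by split; apply: ideal_sub => g; [case=> [[i]|[]//] | case=> [[i [j []]]|[]//]]; rewrite inE.
have [M0|[v vM]] := set_0Vmem M; first by apply: IH; rewrite M0 cards0.
apply: (@reg_le_var _ _ _ (lshift n v)); first exact: homgens_clique_forest.
  exact: nzd_clique.
have hP := homgens_addgen (homogX K (lshift n v)) (homgens_clique_forest (M := M) (E := [::])).
apply: (@reg_le_sub _ _ _ (vars_forest M [::]) (y v) 1 _ 0) => //.
- exact: homogX.
- by move=> p; exact: colon_clique_yv.
- exact: reg_vars_forest.
apply: (reg_le_ext (fun p => iff_sym (clique_forest_del [::] p vM))).
have fM k : vtx k = v -> forall p, clique_forest (M :\ v) [::] p -> free k p.
  by move=> kv p; apply: free_clique_forest; rewrite kv ?inE ?eqxx.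
apply: (@reg_le_nzd _ _ _ _ 1 1).
- exact/homgens_addgen/homgens_clique_forest/homogX.
- exact: homogX.
- apply: nzd_var => p [|->]; last exact: free_yx.
  by apply: fM; exact: vtx_rshift.
apply: (@reg_le_nzd _ _ _ _ 1 1).
- exact: homgens_clique_forest.
- exact: homogX.
- by apply/nzd_var/fM; exact: vtx_lshift.
by apply: IH; rewrite (cardsD1 v M) vM in hM.
Qed.

Lemma reg_clique_forest M E : valid M E -> reg_le (clique_forest M E) (size E).+1.
Proof.
elim: E => [|[z u] E IH] vE; first exact: reg_clique.
apply: (reg_le_ext (fun p => iff_sym (clique_forest_cons M E z u p))).
rewrite -addn1; apply: (@reg_le_nzd _ _ _ _ 2).
- exact: homgens_clique_forest.
- exact: homog_fgen.
- exact: nzd_leaf_clique_forest.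
by apply: IH; case/and4P: vE.
Qed.

(** The colon at each leaf is again a clique with the forest [E], of regularity at most
    [(size E).+1]; it contributes one more than that, whatever the number of leaves. *)
Lemma reg_with_star M E v (U : seq 'I_n) :
  valid M E -> v \in M -> avoids E v -> uniq U ->
  {in U, forall w, w \notin M /\ avoids E w} ->
  reg_le (with_star M E v U) (size E).+2.
Proof.
move=> vE vM aE; elim: U => [|u U IH] uU hU.
  exact: reg_leW (leqnSn _) (reg_clique_forest vE).
have hU' : {in U, forall w, w \notin M /\ avoids E w}.
  by move=> w wU; apply: hU; rewrite inE wU orbT.
apply: (reg_le_ext (fun p => iff_sym (clique_forest_cons M _ v u p))).
apply: (@reg_le_quot _ _ _ (clique_forest (M :|: [set w in U]) E) _ 2 _ (size E).+1).
- exact: homgens_clique_forest.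
- exact: homog_fgen.
- by move=> p; apply: iff_sym; apply: (@colon_star _ _ M E v U u).
- by rewrite addn2.
- by apply: IH => //; case/andP: uU.
by apply/reg_clique_forest/valid_star => // w /hU'[].
Qed.

Lemma knontriv_ext P Q i j : (forall p, ideal P p <-> ideal Q p) ->
  knontriv P i j -> knontriv Q i j.
Proof.
move=> PQ [z [[hz dz] nz]]; exists z; split; first by split=> // B; exact/PQ.
by case=> _ [w [hw zw]]; apply: nz; split=> //; exists w; split=> // A; exact/PQ.
Qed.

Lemma knontriv_fgen P z u i j : homgens P -> nzd P (f_ z u) -> knontriv P i j ->
  knontriv (addgen P (f_ z u)) i.+1 (j + 2).
Proof.
have -> : f_ z u = 'X_(lshift n z) * y u + 'X_(lshift n u) * (- y z).
  by rewrite /fgen mulrN.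
by move=> hP; apply: knontriv_nzd => //; [|rewrite rpredN]; exact: homogX.
Qed.

Lemma fgenC i j : f_ j i = - f_ i j.
Proof. by rewrite /fgen opprB. Qed.

Lemma fgenxx i : f_ i i = 0.
Proof. exact: subrr. Qed.

(** The class comes from the single binomial of [a] and [b]; modulo the variables of all other
    vertices, every clique generator becomes 0 or that binomial up to sign. *)
Lemma knontriv_clique M a b : a \in M -> b \in M -> a != b ->
  knontriv (clique_forest M [::]) 1 2.
Proof.
move=> aM bM ab; pose Z := fun _ : S => False.
have hZ : homgens Z by [].
have nab : nzd Z (f_ a b) by apply: nzd_leaf_x => //; exact: nzd_var.
apply: (@knontriv_addvars _ _ (addgen Z (f_ a b)) _
  [seq k <- enum 'I_(n + n) | (vtx k != a) && (vtx k != b)]).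
- exact: homgens_addgen (homog_fgen a b) hZ.
- by rewrite filter_uniq // enum_uniq.
- by move=> k; rewrite mem_filter => /andP[/andP[ka kb] _] p [//|->]; exact: free_fgen.
- by move=> p [//|->]; apply: ideal_gen; left; exists a, b.
- set s := [seq k <- _ | _]; move=> p [[i [j [iM jM ->]]]|[]//].
  have vs k : (vtx k != a) && (vtx k != b) -> ideal (addvars (addgen Z (f_ a b)) s) ('X_k).
    by move=> h; apply: ideal_addvars_var; rewrite mem_filter h mem_enum.
  have xs c : (c != a) && (c != b) -> ideal (addvars (addgen Z (f_ a b)) s) (x c).
    by move=> h; apply: vs; rewrite vtx_lshift.
  have ys c : (c != a) && (c != b) -> ideal (addvars (addgen Z (f_ a b)) s) (y c).
    by move=> h; apply: vs; rewrite vtx_rshift.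
  have fab : ideal (addvars (addgen Z (f_ a b)) s) (f_ a b).
    exact/ideal_addvarsW/ideal_addgen_gen.
  case ic : ((i != a) && (i != b)).
    by rewrite /fgen; apply: idealB; [apply/idealMr/xs|apply/idealMl/ys].
  case jc : ((j != a) && (j != b)).
    by rewrite /fgen; apply: idealB; [apply/idealMl/ys|apply/idealMr/xs].
  move/negbT: ic; move/negbT: jc; rewrite !negb_and !negbK.
  by case/orP=> /eqP -> /orP[] /eqP ->; rewrite ?fgenxx ?(fgenC a b) //;
    do ?[exact: ideal0 | exact: idealN].
by apply: (@knontriv_fgen _ _ _ 0 0) => //; exact: knontriv_zero.
Qed.

Lemma knontriv_clique_forest M E a b : a \in M -> b \in M -> a != b -> valid M E ->
  knontriv (clique_forest M E) (size E).+1 ((size E).+1 + (size E).+1).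
Proof.
move=> aM bM ab; elim: E => [|[z u] E IH] vE; first exact: (knontriv_clique aM bM).
apply: (knontriv_ext (fun p => iff_sym (clique_forest_cons M E z u p))).
have -> : ((size ((z, u) :: E)).+1 + (size ((z, u) :: E)).+1 =
  (size E).+1 + (size E).+1 + 2)%N by rewrite /=; lia.
apply: knontriv_fgen; first exact: homgens_clique_forest.
  exact: nzd_leaf_clique_forest.
by apply: IH; case/and4P: vE.
Qed.

(** The first leaf [u] still extends the regular sequence of attachments and raises the degree; the
    leaves in [U] are edges at new vertices, which vanish modulo the variables of these vertices. *)
Lemma knontriv_with_star M E v u (U : seq 'I_n) a b :
  a \in M -> b \in M -> a != b ->
  valid M E -> v \in M -> avoids E v -> uniq (u :: U) ->
  {in u :: U, forall w, w \notin M /\ avoids E w} ->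
  knontriv (with_star M E v (u :: U)) (size E).+2 ((size E).+2 + (size E).+2).
Proof.
move=> aM bM ab vE vM aE /andP[uU uniqU] hU.
have [uM uE] := hU u (mem_head _ _).
have vE1 : valid M ((v, u) :: E) by rewrite /= vE uM uE /attachable vM aE.
have := knontriv_clique_forest aM bM ab vE1.
apply: (@knontriv_addvars _ _ _ _ [seq k <- enum 'I_(n + n) | vtx k \in U]).
- exact: homgens_clique_forest.
- by rewrite filter_uniq // enum_uniq.
- move=> k; rewrite mem_filter => /andP[kU _] p.
  have [kM kE] := hU (vtx k) (mem_behead (s := u :: U) kU).
  apply: free_clique_forest => //; rewrite avoids_cons kE andbT /=; apply/andP; split.
    by apply: contraNneq kM => ->.
  by apply: contraNneq uU => <-.
- move=> p [h|[e]]; first by apply: ideal_gen; left.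
  rewrite inE => /orP[/eqP-> ->|eE ->]; apply: ideal_gen; right.
    by exists (v, u); rewrite // inE eqxx.
  by exists e; rewrite // inE mem_cat eE !orbT.
move=> p [h|[e]]; first by apply/ideal_addvarsW/ideal_gen; left.
rewrite /= inE mem_cat => /or3P[/eqP-> ->|/mapP[w wU ->] ->|eE ->].
- by apply/ideal_addvarsW/ideal_gen; right; exists (v, u); rewrite // inE eqxx.
- rewrite /fgen /=; apply: idealB; [apply: idealMl|apply: idealMr];
  by apply: ideal_addvars_var; rewrite mem_filter mem_enum ?vtx_lshift ?vtx_rshift wU.
by apply/ideal_addvarsW/ideal_gen; right; exists e; rewrite // inE eE orbT.
Qed.

End Regularity.

(** * Betti numbers *)

Section Dimension.
Variables (K : fieldType) (V : lmodType K).

Definition independent d (b : 'I_d -> V) :=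
  forall c : 'I_d -> K, \sum_(k < d) c k *: b k = 0 -> forall k, c k = 0.

Definition spans d (b : 'I_d -> V) v := exists c : 'I_d -> K, v = \sum_(k < d) c k *: b k.

(** If [q < p], the matrix of coefficients has a nonzero left kernel vector, which is a linear
    relation among the [a k]. *)
Lemma independent_leq p q (a : 'I_p -> V) (b : 'I_q -> V) :
  independent a -> (forall k, spans b (a k)) -> (p <= q)%N.
Proof.
move=> ia /fin_all_exists[c hc]; rewrite leqNgt; apply/negP => qp.
pose C := \matrix_(i, j) c i j.
have : kermx C != 0.
  rewrite kermx_eq0 /row_free; apply/eqP => h.
  by have := rank_leq_col C; rewrite h leqNgt qp.
case/rowV0Pn => u /sub_kermxP uC /rV0Pn[k]; rewrite (ia (fun k => u 0 k)) ?eqxx //.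
under eq_bigr do rewrite hc scaler_sumr.
rewrite exchange_big big1 //= => l _.
under eq_bigr do rewrite scalerA.
rewrite -scaler_suml; move/rowP/(_ l): uC; rewrite !mxE => E.
by under eq_bigr => k' _ do [have -> : c k' l = C k' l by rewrite mxE]; rewrite E scale0r.
Qed.

Lemma has_dim_leq (P Q : V -> Prop) p q : (forall v, P v -> Q v) ->
  has_dim P p -> has_dim Q q -> (p <= q)%N.
Proof.
move=> PQ [a [Pa [ia _]]] [b [_ [_ sb]]].
by apply: (independent_leq ia) => k; exact/sb/PQ.
Qed.

Lemma independent_extend d (b : 'I_d -> V) v : independent b -> ~ spans b v ->
  independent (fun k : 'I_d.+1 => if unlift ord0 k is Some k' then b k' else v).
Proof.
move=> ib nv c; rewrite big_ord_recl unlift_none.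
under eq_bigr do rewrite liftK.
move=> hc; have c0 : c ord0 = 0.
  apply/eqP/negP => /negP c0; apply: nv; exists (fun k => - (c ord0)^-1 * c (lift ord0 k)).
  under eq_bigr do rewrite -scalerA.
  rewrite -scaler_sumr; move/eqP: hc; rewrite addr_eq0 => /eqP hc.
  by rewrite -[\sum_(k < d) _]opprK -hc scalerN scaleNr opprK scalerA mulVf // scale1r.
rewrite c0 scale0r add0r in hc.
by move=> k; case: (unliftP ord0 k) => [k' ->|-> //]; exact: (ib _ hc).
Qed.

(** The sizes of independent families in [P] are bounded by [N]; a family of largest size spans,
    since otherwise it could be extended. *)
Lemma has_dim_exists (P : V -> Prop) N (g : 'I_N -> V) :
  (forall v, P v -> spans g v) -> exists d, has_dim P d.
Proof.
move=> Pg; pose Q d := exists b : 'I_d -> V, (forall k, P (b k)) /\ independent b.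
have [d [[b [Pb ib]] nQ]] : exists d, Q d /\ ~ Q d.+1.
  apply: NNPP => H; have all d : Q d.
    elim: d => [|d IH]; first by exists (fun=> 0); split=> [[]|c _ []].
    by apply: NNPP => nQ; apply: H; exists d.
  have [b [Pb ib]] := all N.+1.
  have := independent_leq ib (fun k => Pg _ (Pb k)).
  by rewrite ltnn.
exists d, b; split=> //; split=> // v Pv; apply: NNPP => nv; apply: nQ.
exists (fun k : 'I_d.+1 => if unlift ord0 k is Some k' then b k' else v); split.
  by move=> k; case: unliftP.
exact: independent_extend.
Qed.

Lemma has_dim_ltn (P Q : V -> Prop) v p q : (forall u, P u -> Q u) ->
  (forall (I : finType) (c : I -> K) (F : I -> V),
     (forall k, P (F k)) -> P (\sum_k c k *: F k)) ->
  Q v -> ~ P v -> has_dim P p -> has_dim Q q -> (p < q)%N.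
Proof.
move=> PQ Psum Qv nPv [a [Pa [ia sa]]] [b [_ [_ sb]]].
have nv : ~ spans a v by move=> [c E]; apply: nPv; rewrite E; exact: Psum.
apply: (independent_leq (independent_extend ia nv)) => k.
by case: unliftP => [k' _|_]; apply: sb => //; exact: PQ.
Qed.

End Dimension.

Section Betti.
Variables (K : fieldType) (n : nat).
Local Notation S := {mpoly K[n + n]}.
Local Notation chain := (kchain K n).
Local Notation nn := (n + n)%N.

Lemma msize_dhomog d (p : S) : p \is d.-homog -> (msize p <= d.+1)%N.
Proof.
move=> /dhomogP hp; rewrite msizeE; apply/bigmax_leqP_seq => m mp _.
by rewrite ltnS; have /= -> := hp _ mp.
Qed.

(** Finitely many elements, a monomial of degree at most [j] at one subset, span the chains of given
    degrees; so the dimensions defining Betti numbers exist. *)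
Lemma kdeg_spans i j : exists N (g : 'I_N -> chain),
  forall c, kdeg i j c -> spans g c.
Proof.
pose T := ({set 'I_(n + n)} * 'X_{1..nn < j.+1})%type.
pose g (t : T) : chain :=
  [ffun B : {set 'I_(n + n)} => if B == t.1 then 'X_[t.2] else 0].
exists #|{: T}|, (fun k => g (enum_val k)) => c hc.
pose h (t : T) : K := (c t.1)@_(t.2).
exists (fun k => h (enum_val k)).
rewrite -(big_enum_val (A := {: T}) (fun t : T => h t *: g t)) /=.
apply/ffunP => B; rewrite sum_ffunE.
rewrite (eq_bigr (fun t : T => if B == t.1 then (c B)@_(t.2) *: 'X_[t.2] else 0)); last first.
  by move=> t _; rewrite !ffunE /h; case: eqP => [<-|_]; rewrite ?scaler0.
rewrite -(pair_bigA _ (fun A (m : 'X_{1..nn < j.+1}) =>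
   if B == A then (c B)@_m *: 'X_[m] else 0)) /=.
rewrite (bigD1 B) //= eqxx [X in _ + X]big1 ?addr0; last first.
  by move=> A AB; apply: big1 => m _; rewrite eq_sym (negbTE AB).
apply: mpolywE; case: (hc B) => [->|[_ [d [<- hd]]]]; first by rewrite msize0.
by apply: leq_trans (msize_dhomog hd) _; rewrite ltnS leq_addl.
Qed.

Variables (G : sgraph n) (P : S -> Prop).
Hypothesis JGP : forall p, in_JG G p <-> ideal P p.

Lemma kcycleE i j c : kcycle G i j c <-> kcyc P i j c.
Proof. by split=> -[h d]; split=> // B; exact/JGP. Qed.

Lemma kboundE i j c : kbound G i j c <-> kbnd P i j c.
Proof. by split=> -[h [w [hw cw]]]; split=> //; exists w; split=> // A; exact/JGP. Qed.

Lemma kbnd_kcyc i j c : kbnd P i j c -> kcyc P i j c.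
Proof.
move=> [hc [w [_ cw]]]; split=> // B.
have := @ideal_kdiff _ _ P (c - kdiff w) _ B.
by rewrite kdiffB kdiff_kdiff subr0; apply=> A; rewrite chainB.
Qed.

Lemma kdiff0 B : kdiff (0 : chain) B = 0.
Proof. by rewrite kdiffE big1 // => k _; rewrite ffunE mulr0. Qed.

Lemma kbnd_sum i j (I : finType) (c : I -> K) (F : I -> chain) :
  (forall k, kbnd P i j (F k)) -> kbnd P i j (\sum_k c k *: F k).
Proof.
move=> hF; apply: big_ind => [|a b [ha [w [hw aw]]] [hb [w' [hw' bw']]]|k _].
- have h0 l : kdeg l j (0 : chain) by move=> A; left; rewrite ffunE.
  by split=> //; exists 0; split=> // A; rewrite kdiff0 subr0 ffunE; exact: ideal0.
- split; first exact: kdegD.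
  exists (w + w'); split=> [|A]; first exact: kdegD.
  by rewrite kdiffD [(a + b) A]ffunE opprD addrACA; apply: idealD.
have [ha [w [hw aw]]] := hF k.
have E (z : chain) : c k *: z = cmul (c k)%:MP z.
  by apply/ffunP => A; rewrite cmulE ffunE mul_mpolyC.
have hC : ((c k)%:MP : S) \is 0.-homog.
  by rewrite -[(c k)%:MP]mulr1 mul_mpolyC; apply: dhomogZ; exact: dhomog1.
split; first by rewrite E -(addn0 j); exact: kdeg_cmul.
exists (cmul (c k)%:MP w); split; first by rewrite -(addn0 j); exact: kdeg_cmul.
by move=> A; rewrite E kdiff_cmul cmulE -mulrBr; exact: idealMl.
Qed.

(** When cycles are boundaries, [dz <= db] and the truncated difference is 0. *)
Lemma betti_nonzero i j b : betti_is K G i j b -> b <> 0%N -> ~ kvan P i j.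
Proof.
move=> [dz [db [hz [hb ->]]]] b0 van; apply/b0/eqP; rewrite subn_eq0.
by apply: has_dim_leq hz hb => c /kcycleE/van/kboundE.
Qed.

Lemma betti_exists i j : knontriv P i j -> exists b, betti_is K G i j b /\ b <> 0%N.
Proof.
move=> [z [hz nz]]; have [N [g hg]] := kdeg_spans i j.
have [dz Hz] : exists d, has_dim (@kcycle K n G i j) d.
  by apply: (has_dim_exists (g := g)) => c [hc _]; exact: hg.
have [db Hb] : exists d, has_dim (@kbound K n G i j) d.
  by apply: (has_dim_exists (g := g)) => c [hc _]; exact: hg.
exists (dz - db)%N; split; first by exists dz, db.
apply/eqP; rewrite subn_eq0 -ltnNge.
apply: (has_dim_ltn (v := z)) Hb Hz.
- by move=> c /kboundE/kbnd_kcyc/kcycleE.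
- by move=> I c F hF; apply/kboundE/kbnd_sum => k; exact/kboundE.
- exact/kcycleE.
by move/kboundE.
Qed.

Lemma reg_quot_isP r i : reg_le P r -> knontriv P i (i + r) -> reg_quot_is K G r.
Proof.
move=> hr hn; split.
  by have [b [hb b0]] := betti_exists hn; exists i, (i + r)%N, b.
move=> i' j b hb b0; rewrite leqNgt; apply/negP => h.
by apply: (betti_nonzero hb b0); exact: hr.
Qed.

End Betti.

(** * The graph *)

Section EdgeIdeal.
Variables (K : fieldType) (n : nat) (G : sgraph n).

Definition edge_gens (p : {mpoly K[n + n]}) : Prop :=
  exists i j, adj G i j /\ p = fgen K i j.

Lemma in_JG_add (i j : 'I_n) a p : (i < j)%N -> adj G i j -> in_JG G p -> in_JG G (a * fgen K i j + p).
Proof.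
move=> ij Aij [g ->].
(* Only the coefficient at the pair [(i, j)] is changed, by [a]. *)
exists (fun i' j' => (if (i' == i) && (j' == j) then a else 0) + g i' j').
under [RHS]eq_bigr do under eq_bigr do rewrite mulrDl.
under [RHS]eq_bigr do rewrite big_split.
rewrite big_split /=; congr (_ + _).
rewrite (bigD1 i) //= (bigD1 j) ?ij //= !eqxx big1 => [|j' /andP[_ /negbTE->]]; last first.
  by rewrite andbF mul0r.
rewrite big1 ?addr0 // => i' /negbTE i'i; apply: big1 => j' _.
by rewrite i'i mul0r.
Qed.

Lemma in_JGE p : in_JG G p <-> ideal edge_gens p.
Proof.
split=> [[g ->]|].
  apply: ideal_sum => i _; apply: ideal_sum => j /andP[_ Aij].
  by apply/idealMl/ideal_gen; exists i, j.
elim=> [|a g q [i [j [Aij ->]]] _ IH].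
  by exists (fun _ _ => 0); rewrite big1 // => i _; rewrite big1 // => j _; rewrite mul0r.
case: (ltngtP i j) => ij; first exact: in_JG_add.
  by rewrite (fgenC _ j i) mulrN -mulNr; apply: in_JG_add => //; rewrite adj_sym.
by move: Aij; rewrite (val_inj ij) adj_irr.
Qed.

End EdgeIdeal.

Section Graph.
Local Open Scope nat_scope.
(* The clique [{0..q+1}]; the path [q+2, .., q+1+a] attached at [0]; one leaf at
   each of [1..q]; [t + 1] leaves at [q + 1]. *)
Variables (q a t : nat).
Hypothesis a_gt0 : (0 < a)%N.
Local Notation n := (q + a + q + t).+3.
Local Notation m := q.+2.

(** The [minn] hangs the first [q] leaves on [1..q] and all later ones on [q + 1]. *)
Definition parent (u : nat) : nat :=
  if u == m then 0%N else if (u < m + a)%N then u.-1 else minn (u - (m + a)).+1 q.+1.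

Definition adjn (i j : nat) : bool :=
  [|| [&& i < m, j < m & i != j], (m <= j) && (i == parent j) | (m <= i) && (j == parent i)]%N.

Lemma parent_lt u : (m <= u)%N -> (parent u < u)%N.
Proof. by rewrite /parent; case: eqP => [->|] //; case: ifP; lia. Qed.

Lemma adjn_sym i j : adjn i j = adjn j i.
Proof. by rewrite /adjn; lia. Qed.

Lemma adjn_irr i : adjn i i = false.
Proof. by rewrite /adjn; have := @parent_lt i; lia. Qed.

Definition graph : sgraph n :=
  @SGraph n (fun i j => adjn i j) (fun i j => adjn_sym i j) (fun i => adjn_irr i).

Lemma graph_connected : connected_graph graph.
Proof.
have c0 (u : 'I_n) : connect (adj graph) u ord0.
  move: {2}(nat_of_ord u) (leqnn u) => d; elim: d u => [|d IH] u ud.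
    by have -> : u = ord0 by apply: val_inj => /=; lia.
  have [um|um] := ltnP u m.
    have [->|u0] := eqVneq u ord0; first exact: connect0.
    by apply: connect1; rewrite /= /adjn um /= u0.
  have pu := parent_lt um; pose w : 'I_n := Ordinal (ltn_trans pu (ltn_ord u)).
  apply: (@connect_trans _ _ w); last by apply: IH => /=; lia.
  by apply: connect1; rewrite /= /adjn um eqxx !orbT.
move=> u v; apply: connect_trans (c0 u) _.
have /sym_connect_sym -> : ssrbool.symmetric (adj graph) by exact: adj_sym.
exact: c0.
Qed.

Lemma adjn_le i j : (j < i)%N -> (m <= i)%N -> adjn i j -> j = parent i.
Proof. by rewrite /adjn; have := @parent_lt j; lia. Qed.

(* [q.+1 + a <= i] selects the end of the path and the leaves. *)
Lemma adjn_leaf i j : (q.+1 + a <= i)%N -> adjn i j -> j = parent i.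
Proof.
move=> hi; rewrite /adjn => /or3P[|/andP[mj /eqP ij]|/andP[_ /eqP]//]; first lia.
by move: ij; rewrite /parent; case: eqP => [->|]; [|case: ifP]; lia.
Qed.

Lemma card_interval lo hi : (#|[set i : 'I_n | lo <= i < hi]| <= hi - lo)%N.
Proof.
rewrite cardE -(size_map val) -[X in (_ <= X)%N](size_iota lo).
apply: uniq_leq_size; first by rewrite map_inj_uniq ?enum_uniq //; exact: val_inj.
move=> k /mapP[i]; rewrite mem_enum inE => /andP[h1 h2] ->.
by rewrite mem_iota h1 /=; lia.
Qed.

(** Counts the [k - 1] interior vertices: at most two in the clique, and at most [a - 1] on the
    attached path. *)
Lemma induced_path_leq k p : @induced_path n graph k p -> (k <= a.+2)%N.
Proof.
move=> [pinj padj]; have [//|k1] := leqP k 1; first lia.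
pose I := [set c : 'I_k.+1 | 0 < c < k].
have cI : (k.-1 <= #|I|)%N.
  have -> : I = ~: [set ord0; ord_max].
    apply/setP => c; rewrite !inE negb_or -!val_eqE /= -lt0n.
    by have := ltn_ord c; lia.
  have := cardsC [set ord0; ord_max : 'I_k.+1]; rewrite cards2 card_ord -val_eqE /=.
  by rewrite (_ : 0 == k = false); lia.
pose J := [set c in I | p c < m].
(* Three vertices in the clique would have pairwise consecutive indices. *)
have cJ : (#|J| <= 2)%N.
  rewrite leqNgt; apply/negP => /card_gt2P[c [d [e [[]]]]].
  rewrite !inE => /andP[_ hc] /andP[_ hd] /andP[_ he] [cd de ec].
  have adjM c' d' : (p c' < m)%N -> (p d' < m)%N -> c' != d' ->
      (val c' == (val d').+1) || (val d' == (val c').+1).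
    by move=> h h' ne; rewrite -padj /= /adjn h h' /= (inj_eq val_inj) (inj_eq pinj) ne.
  by have := (adjM _ _ hc hd cd, adjM _ _ hd he de, adjM _ _ he hc ec) => -[[]]; lia.
(* An interior vertex has two distinct neighbours, so it is neither a leaf nor the end of the
   attached path. *)
have Isub : p @: (I :\: J) \subset [set u : 'I_n | m <= u < q.+1 + a]%N.
  apply/subsetP => _ /imsetP[c + ->]; rewrite !inE => /andP[+ /andP[c0 ck]].
  rewrite c0 ck /= -leqNgt => -> /=; rewrite ltnNge; apply/negP => leaf.
  have hs : (c.+1 < k.+1)%N by [].
  have hp : (c.-1 < k.+1)%N by lia.
  have := padj c (Ordinal hs); rewrite /= eqxx orbT => /(adjn_leaf leaf) e1.
  have := padj c (Ordinal hp); rewrite /= prednK // eqxx /= => /(adjn_leaf leaf) e2.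
  have /pinj/(congr1 val) /= : p (Ordinal hs) = p (Ordinal hp).
    by apply: val_inj; rewrite /= e1 e2.
  lia.
have := subset_leq_card Isub; rewrite card_imset // cardsD.
have -> : I :&: J = J by apply/setIidPr/subsetP => c; rewrite inE => /andP[].
by have := card_interval m (q.+1 + a); lia.
Qed.

(** Runs down the attached path from its end to the clique vertex 0, crosses to [q + 1] and ends at
    the first star leaf. *)
Definition long_path (k : nat) : nat :=
  if (k < a)%N then (m + (a.-1 - k))%N else if k == a then 0%N
  else if k == a.+1 then q.+1 else (m + a + q)%N.

Lemma long_path_lt k : (long_path k < n)%N.
Proof. by rewrite /long_path; do ![case: ifP => _]; lia. Qed.

Lemma long_path_inj k k' : (k < a.+3)%N -> (k' < a.+3)%N ->
  long_path k = long_path k' -> k = k'.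
Proof.
by rewrite /long_path; do ![case: ifP => ?]; lia.
Qed.

Lemma long_path_adj k k' : (k < a.+3)%N -> (k' < a.+3)%N ->
  adjn (long_path k) (long_path k') = (k == k'.+1) || (k' == k.+1).
Proof.
have F i : i < a.+3 ->
    [\/ [/\ i < a, long_path i = m + (a.-1 - i) &
           parent (long_path i) = if i.+1 == a then 0 else m + (a.-1 - i).-1],
        i = a /\ long_path i = 0, i = a.+1 /\ long_path i = q.+1
      | [/\ i = a.+2, long_path i = m + a + q & parent (long_path i) = q.+1]].
  move=> hi; have [ia|ia] := ltnP i a.
    constructor 1; have E : long_path i = m + (a.-1 - i) by rewrite /long_path ia.
    split=> //; rewrite E /parent; case: (i.+1 =P a) => h; first by rewrite ifT //; lia.
    by rewrite ifF ?ifT //; lia.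
  have : [\/ i = a, i = a.+1 | i = a.+2].
    by case: (ltngtP i a.+1) => h; [constructor 1|constructor 3|constructor 2]; lia.
  case=> ->; [constructor 2|constructor 3|constructor 4].
  - by rewrite /long_path ltnn eqxx.
  - by rewrite /long_path ltnNge leqnSn /= eqxx ifF //; lia.
  have E : long_path a.+2 = m + a + q by rewrite /long_path !ifF //; lia.
  by split=> //; rewrite E /parent !ifF //; lia.
move=> /F hk /F hk'; rewrite /adjn.
case: hk => [[? -> ->]|[-> ->]|[-> ->]|[-> -> ->]];
case: hk' => [[? -> ->]|[-> ->]|[-> ->]|[-> -> ->]];
repeat case: ifP => ?; lia.
Qed.

Lemma graph_longest : longest_induced_path_is graph a.+2.
Proof.
split; last exact: induced_path_leq.
exists (fun k => Ordinal (long_path_lt k)); split=> [k k' /(congr1 val)|k k'] /=.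
  by move=> /long_path_inj e; apply: val_inj; apply: e.
exact: long_path_adj.
Qed.

(** In a clique that leaves the core, the largest vertex is outside the core and its only smaller
    neighbour is its parent, so there are at most two vertices. *)
Lemma graph_clique_number : clique_number graph = m.
Proof.
pose M := [set i : 'I_n | (i < m)%N].
have cM : #|M| = m.
  have mn : (m <= n)%N by lia.
  have -> : M = [set widen_ord mn i | i : 'I_m].
    apply/setP => i; rewrite inE; apply/idP/imsetP => [im|[j _ ->] /=]; last exact: ltn_ord.
    by exists (Ordinal im) => //; apply: val_inj.
  rewrite card_imset ?card_ord // => i j /(congr1 val) /= e; exact: val_inj.
apply/eqP; rewrite eqn_leq; apply/andP; split; last first.
  rewrite -[X in (X <= _)%N]cM; apply: (leq_bigmax_cond (P := is_clique graph)).
  apply/forall_inP => u; rewrite inE => um; apply/forall_inP => v; rewrite inE => vm.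
  by apply/implyP => uv; rewrite /= /adjn um vm /= (inj_eq val_inj) uv.
apply/bigmax_leqP => C /forall_inP hC.
have [CM|/subsetPn[u0 u0C u0M]] := boolP (C \subset M).
  by rewrite -cM; exact: subset_leq_card.
have [u uC umax] := @arg_maxnP _ u0 (mem C) val u0C.
have um : (m <= u)%N.
  by have := umax _ u0C; move: u0M; rewrite inE -leqNgt => h1 h2; exact: leq_trans h1 h2.
pose w : 'I_n := Ordinal (ltn_trans (parent_lt um) (ltn_ord u)).
suff /subset_leq_card/leq_trans : C \subset [set u; w].
  by apply; rewrite cards2; case: eqP.
apply/subsetP => c cC; rewrite !inE; have [//|cu] := eqVneq c u.
apply/eqP/val_inj => /=; apply: adjn_le => //.
  by rewrite ltn_neqAle (inj_eq val_inj) cu; exact: umax.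
by move: (hC _ uC) => /forall_inP/(_ _ cC)/implyP; apply; rewrite eq_sym.
Qed.

(** * The edge ideal of the graph as a clique with forest and star *)

Variable K : fieldType.
Local Notation f_ := (@fgen K n).

Definition core : {set 'I_n} := [set i : 'I_n | i < m].

(** The list is reversed because [valid] expects the latest attachment first. *)
Definition forest (k : nat) : seq ('I_n * 'I_n) :=
  [seq (inord (parent u), inord u) | u <- rev (iota m k)].

Definition star_leaves : seq 'I_n := [seq inord u | u <- iota (m + a + q) t.+1].

Lemma avoids_forestP k (z : 'I_n) : k <= a + q ->
  (forall u, m <= u < m + k -> (z : nat) <> parent u /\ (z : nat) <> u) <->
  avoids (forest k) z.
Proof.
move=> ka; rewrite /avoids all_map all_rev; split=> [h|/allP h u hu].
  apply/allP => u; rewrite mem_iota => hu /=; have pu := @parent_lt u.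
  have [h1 h2] := h u hu.
  by apply/andP; split; apply/eqP => /(congr1 val); rewrite /= inordK //; lia.
have := h u; rewrite mem_iota hu /= => /(_ isT)/andP[/eqP h1 /eqP h2].
have pu := @parent_lt u.
by split=> e; [apply: h1|apply: h2]; apply: val_inj; rewrite /= inordK //; lia.
Qed.

Lemma forestS k : forest k.+1 = (inord (parent (m + k)), inord (m + k)) :: forest k.
Proof.
have E : iota m k.+1 = rcons (iota m k) (m + k) by rewrite -(addn1 k) iotaD cats1.
by rewrite /forest E rev_rcons.
Qed.

Lemma size_forest k : size (forest k) = k.
Proof. by rewrite size_map size_rev size_iota. Qed.

Lemma valid_forest k : k <= a + q -> valid core (forest k).
Proof.
elim: k => [//|k IH] ka; rewrite forestS /=; apply/and4P.
have pk := @parent_lt (m + k).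
split; first by apply: IH; lia.
- by rewrite inE inordK; lia.
- apply/avoids_forestP; first lia.
  by move=> u hu; have pu := @parent_lt u; rewrite inordK; lia.
(* The new edge starts the path at 0, prolongs the path at its current end, or hangs a single leaf
   on the untouched clique vertex [k - a + 1]. *)
have [k0|[k0 ka']|ka'] : [\/ k = 0, 0 < k /\ k < a | a <= k].
    by case: (posnP k); [constructor 1|case: (ltnP k a); [constructor 2|constructor 3]].
- rewrite k0 /attachable /= andbT orbF inE inordK; rewrite /parent addn0 eqxx //.
- apply/orP; right; case: k k0 pk {IH ka} ka' => // k _ _ ka'; rewrite forestS /=.
  apply/eqP; congr inord; rewrite /parent ifF ?ifT; lia.
apply/orP; left; rewrite inE.
have E : parent (m + k) = (k - a).+1.
  by rewrite /parent ifF ?ifF; lia.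
rewrite E inordK; last lia.
apply/andP; split; first lia.
apply/avoids_forestP; first lia.
move=> u hu; rewrite inordK; last lia.
by split; last lia; rewrite /parent; case: eqP => [//|?]; case: ifP; lia.
Qed.

Lemma in_graph_idealE p : in_JG graph p <->
  ideal (@with_star K n core (forest (a + q)) (inord q.+1) star_leaves) p.
Proof.
pose gens := @with_star K n core (forest (a + q)) (inord q.+1) star_leaves.
have par (u : 'I_n) : m <= u -> ideal gens (f_ (inord (parent u)) u).
  move=> um; apply: ideal_gen; right.
  have pu := parent_lt um; exists (inord (parent u), u) => //; rewrite mem_cat.
  have [uf|us] := ltnP u (m + (a + q)); apply/orP; [right|left]; apply/mapP.
    by exists (val u); rewrite ?mem_rev ?mem_iota ?um ?inord_val.
  exists u.
    by apply/mapP; exists (val u); rewrite ?inord_val // mem_iota; have /= := ltn_ord u; lia.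
  by congr (inord _, _); rewrite /parent ifF ?ifF; lia.
split=> [/in_JGE|] h; [|apply/in_JGE]; apply: ideal_sub h => g.
  move=> [i [j [/or3P[/and3P[im jm _]|/andP[jm /eqP ij]|/andP[im /eqP ji]] ->]]].
  - by apply: ideal_gen; left; exists i, j; rewrite !inE.
  - by have := par _ jm; rewrite -ij inord_val.
  by have := par _ im; rewrite -ji inord_val fgenC => /idealN; rewrite opprK.
have gen (i j : 'I_n) : i = parent j :> nat -> m <= j -> ideal (edge_gens graph) (f_ i j).
  by move=> ij jm; apply: ideal_gen; exists i, j; rewrite /= /adjn jm ij eqxx !orbT.
case=> [[i [j []]]|[e]].
  rewrite !inE => im jm ->; have [->|ij] := eqVneq i j; first by rewrite fgenxx; exact: ideal0.
  by apply: ideal_gen; exists i, j; rewrite /= /adjn im jm (inj_eq val_inj) ij.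
rewrite mem_cat => /orP[/mapP[w /mapP[u]]|/mapP[u]].
  rewrite mem_iota => hu -> -> -> /=; apply: gen; rewrite !inordK; try lia.
  by rewrite /parent ifF ?ifF; lia.
rewrite mem_rev mem_iota => hu -> -> /=; have pu := @parent_lt u.
by apply: gen; rewrite !inordK; lia.
Qed.

Lemma graph_reg : reg_quot_is K graph (a + q).+2.
Proof.
have vM : (inord q.+1 : 'I_n) \in core by rewrite inE inordK //; lia.
have vE := valid_forest (leqnn (a + q)).
have aE : avoids (forest (a + q)) (inord q.+1).
  apply/avoids_forestP => // u hu; rewrite inordK; last lia.
  by split; last lia; rewrite /parent; case: eqP => [//|?]; case: ifP; lia.
have uU : uniq star_leaves.
  rewrite map_inj_in_uniq ?iota_uniq // => u w; rewrite !mem_iota => hu hw /(congr1 val).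
  by rewrite /= !inordK //; lia.
have hU : {in star_leaves, forall w, w \notin core /\ avoids (forest (a + q)) w}.
  move=> _ /mapP[u + ->]; rewrite mem_iota => hu; split; first by rewrite inE inordK; lia.
  apply/avoids_forestP => // w hw; have pw := @parent_lt w.
  by rewrite inordK; lia.
have o0 : (ord0 : 'I_n) \in core by rewrite inE.
have ne : (ord0 : 'I_n) != inord q.+1 by rewrite -val_eqE /= inordK //; lia.
apply: (reg_quot_isP (i := (a + q).+2) in_graph_idealE).
  by rewrite -{2}(size_forest (a + q)); exact: reg_with_star.
have := @knontriv_with_star K n core (forest (a + q)) (inord q.+1) (inord (m + a + q))
  [seq inord u | u <- iota (m + a + q).+1 t] ord0 (inord q.+1) o0 vM ne vE vM aE uU hU.
rewrite size_forest; exact.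
Qed.

End Graph.

Theorem theorem3p6 (K : fieldType) (l r w : nat) :
  (3 <= l)%N -> (l <= r)%N -> (r <= w)%N ->
  exists (n : nat) (G : sgraph n),
    connected_graph G /\
    longest_induced_path_is G l /\
    reg_quot_is K G r /\
    (n - clique_number G + 1)%N = w.
Proof.
move=> l3 lr rw.
have a0 : (0 < l - 2)%N by lia.
(* With [q = r - l], [a = l - 2] and [t = w - r], the longest induced path has [a + 2 = l] edges,
   the regularity is [a + q + 2 = r], and [n - (q + 2) + 1 = a + q + t + 2 = w]. *)
exists ((r - l) + (l - 2) + (r - l) + (w - r)).+3, (graph (r - l) (w - r) a0).
split; first exact: graph_connected.
split; first by have := graph_longest (r - l) (w - r) a0; rewrite (_ : (l - 2).+2 = l) //; lia.
split.
  have := graph_reg (r - l) (w - r) a0 K.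
  by rewrite (_ : (l - 2 + (r - l)).+2 = r) //; lia.
by rewrite graph_clique_number; lia.
Qed.
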